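(* Let $n\ge1$ and suppose $\alpha,\lambda,\sigma$ are constants with $\alpha\in(0,n+2)$, $\lambda\ge\frac{n+2}{n}$, $\sigma\ge0$, and $\sigma>1+\frac{2-\alpha}{n+2}\lambda$. Let $\varphi:(0,1)\to(0,\infty)$ be continuous with $\lim_{t\to0^+}\varphi(t)=\infty$. Then there exists a positive function $u\in C^\infty(\mathbb{R}^n\times(0,1))\cap L^\lambda(\mathbb{R}^n\times(0,1))$ satisfying $$0\le u_t-\Delta u\le \Big(\iint_{\mathbb{R}^n\times(0,1)}\Phi(x-y,t-s)^{\alpha/n}u(y,s)^\lambda\,dy\,ds\Big)\,u(x,t)^\sigma\quad\text{in }\mathbb{R}^n\times(0,1)$$ such that $u(0,t)\ne O(\varphi(t))$ as $t\to0^+$.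
   Context: $\Phi$ is the heat kernel: $\Phi(x,t)=(4\pi t)^{-n/2}e^{-|x|^2/(4t)}$ for $t>0$ and $\Phi(x,t)=0$ for $t\le0$. *)

(* Defs.v *)
From HB Require Import structures.
From mathcomp Require Import all_boot all_order all_algebra.
From mathcomp Require Import all_classical all_reals all_analysis.
Set Implicit Arguments. Unset Strict Implicit. Unset Printing Implicit Defensive.
Import Order.TTheory GRing.Theory Num.Theory.
Import numFieldNormedType.Exports.
Local Open Scope classical_set_scope.
Local Open Scope ring_scope.

Section heat.
Variables (R : realType) (n : nat).

Definition sqnorm (x : 'rV[R]_n) : R := \sum_(i < n) x ord0 i ^+ 2.

Definition Phi (x : 'rV[R]_n) (t : R) : R :=
  if 0 < t then (4 * pi * t) `^ (- (n%:R / 2)) * expR (- sqnorm x / (4 * t))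
  else 0.

Definition Dx (i : 'I_n) (f : 'rV[R]_n -> R -> R) : 'rV[R]_n -> R -> R :=
  fun x t => derive (fun y => f y t) x (delta_mx ord0 i).
Definition Dt (f : 'rV[R]_n -> R -> R) : 'rV[R]_n -> R -> R :=
  fun x t => derive (f x) t 1.

Definition lap (f : 'rV[R]_n -> R -> R) : 'rV[R]_n -> R -> R :=
  fun x t => \sum_(i < n) Dx i (Dx i f) x t.

Definition strip (x : 'rV[R]_n) (t : R) : Prop := 0 < t < 1.

Fixpoint Ck (k : nat) (f : 'rV[R]_n -> R -> R) : Prop :=
  match k with
  | 0 => forall x t, strip x t ->
      (fun p : 'rV[R]_n * R => f p.1 p.2) z @[z --> (x, t)] --> f x t
  | k'.+1 =>
      (forall x t, strip x t ->
        (fun p : 'rV[R]_n * R => f p.1 p.2) z @[z --> (x, t)] --> f x t) /\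
      (forall x t, strip x t ->
        (forall i : 'I_n, derivable (fun y => f y t) x (delta_mx ord0 i)) /\
        derivable (f x) t 1) /\
      (forall i : 'I_n, Ck k' (Dx i f)) /\ Ck k' (Dt f)
  end.

Definition smooth_strip (f : 'rV[R]_n -> R -> R) : Prop := forall k, Ck k f.

End heat.

(* Lebesgue integral over R^m of a nonnegative extended-real function,
   written as the iterated integral over the coordinates (by Tonelli this
   equals the integral w.r.t. m-dimensional Lebesgue measure for
   nonnegative measurable integrands). *)
Fixpoint iint (R : realType) (m : nat) : ('rV[R]_m -> \bar R) -> \bar R :=
  match m return ('rV[R]_m -> \bar R) -> \bar R with
  | 0 => fun f => f 0
  | m'.+1 => fun f =>
      (\int[@lebesgue_measure R]_(a in [set: R])
          iint (fun y : 'rV[R]_m' => f (row_mx (const_mx (a : R) : 'rV[R]_1) y : 'rV[R]_(1 + m'))))%E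
  end.

Definition STint (R : realType) (n : nat) (F : 'rV[R]_n -> R -> \bar R) : \bar R :=
  (\int[@lebesgue_measure R]_(s in `]0%R, 1%R[%classic) iint (fun y => F y s))%E.

(* Main.v *)
Require Import Defs.
From HB Require Import structures.
From mathcomp Require Import all_boot all_order all_algebra.
From mathcomp Require Import all_classical all_reals all_analysis.
From mathcomp Require Import measurable_realfun ring lra.
Import Order.TTheory GRing.Theory Num.Theory.
Import numFieldNormedType.Exports.
Local Open Scope classical_set_scope.
Local Open Scope ring_scope.

(** Choose [s] with [n < 2 s lambda < n + 2] so large that a function of size
    [r^{-2s}] on a parabolic cylinder of radius [r], which is in [L^lambda], may
    grow at the rate [r^{-2s-2}] allowed by the inequality; the hypothesis on
    [sigma] says that such an [s] exists.

    The background is [K w] with [w = t^{-s} F(1 + |x|^2/t)], of size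
    [(|x|^2 + t)^{-s}].  A finite asymptotic expansion of [F] makes its heat
    source decay as fast as required where [|x|^2] is much larger than [t], the
    region in which the nonlocal term is weak; a Gaussian term in [F] makes the
    source strictly positive.

    Near the times [T_j -> 0] a burst is added: heat kernels born at
    [T_j - 3 r_i], [r_i = 4^{-i-2} T_j], [i < N_j], with mass [r_i^{n/2-s}] and
    switched on smoothly during [[T_j - 2 r_i, T_j - r_i]].  When the [i]-th
    kernel is switched on, the background and the previous kernels already
    bound the solution below by [max(|x|^2, r_i)^{-s}] up to a constant, which
    is what the inequality needs.  The peak at [(0, T_j)] has size
    [r_{N_j - 1}^{-s}], which exceeds [j phi(T_j)] if [N_j] is large.  Later the
    burst is switched off again, the negative source being absorbed by the
    Gaussian part of the source of [K w]; so the sum over [j] is locally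
    finite. *)

(** * Functions of class C^k on a time set *)

Section smoothness.
Set Implicit Arguments.
Unset Strict Implicit.
Context {R : realType} {n : nat}.
Implicit Types (f g : 'rV[R]_n -> R -> R) (O : set R) (x : 'rV[R]_n) (t : R).

(** The window for [s] comes from three exponents. Space integration of [(|x|^2 + t)^{-s lambda}]
    leaves [t^{n/2 - s lambda}], which must be integrable in time. On a cylinder of spatial size
    [sqrt r] the nonlocal term has weight [r^e], [e = (n + 2 - alpha)/2], so the right side is about
    [r^e q^{-M}] with [M = s (lambda + sigma)] and [q] comparable to [|x|^2 + r], against a source
    [r^{M-s-1} q^{-M}]. The gap [M - s - 1 - e > 0] holds at the endpoint [s = (n + 2)/(2 lambda)]
    exactly by the hypothesis on [sigma]; [lambda >= (n + 2)/n] gives [s < n/2], so the masses are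
    summable. Two constants remain free: a large [K] wins for the background, as the right side
    scales like [K^{lambda + sigma}]; a small first peak [T_0] wins for the bursts through the gap.
    Since [N_j] depends on [phi] and is uncontrolled, every estimate must be uniform in it. For the
    [L^lambda] bound this is achieved by a second exponent [s1] slightly above [s], whose surplus
    gives a factor geometric in [i]. *)

Lemma is_derive_comp_dir (V : normedModType R) (f : V -> R) (G : R -> R)
    (x v : V) (df dG : R) :
  is_derive x v f df -> is_derive (f x) 1 G dG ->
  is_derive x v (fun y => G (f y)) (dG * df).
Proof.
move=> [Df Hf] [DG HG].
have Df0 : derivable (fun h : R => f (h *: v + x)) 0 1 by exact: (derivable1P f x v).1.
have E (g : V -> R) : 'D_v g x = 'D_1 (fun h : R => g (h *: v + x)) 0.
  rewrite /derive; set g1 := fun h => h^-1 *: _; set g2 := fun h => h^-1 *: _.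
  suff -> : g1 = g2 by [].
  by rewrite funeqE /g1 /g2 => h /=; rewrite addr0 scale0r add0r [_%:A]mulr1.
have Df0' : is_derive (0 : R) 1 (fun h : R => f (h *: v + x)) df.
  by split => //; rewrite -E.
have DG' : is_derive (f (0 *: v + x)) 1 G dG.
  by rewrite scale0r add0r; split.
have [D1 D2] := @is_derive1_comp R G (fun h : R => f (h *: v + x)) 0 dG df DG' Df0'.
split; first exact: (derivable1P (fun y => G (f y)) x v).2.
by rewrite E.
Qed.

Lemma is_derive_line (V : normedModType R) (f : V -> R) (x v : V) (d : R) :
  is_derive (0 : R) 1 (fun h : R => f (h *: v + x)) d -> is_derive x v f d.
Proof.
move=> [D1 D2]; split; first exact: (derivable1P f x v).2.
rewrite -D2 /derive; set g1 := fun h => h^-1 *: _; set g2 := fun h => h^-1 *: _.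
suff -> : g1 = g2 by [].
by rewrite funeqE /g1 /g2 => h /=; rewrite addr0 scale0r add0r [_%:A]mulr1.
Qed.

(* [None] is the time direction, [Some i] the [i]-th space direction *)
Definition is_partial (o : option 'I_n) f x t (d : R) : Prop :=
  match o with
  | Some i => is_derive x (delta_mx ord0 i) (fun y => f y t) d
  | None => is_derive t 1 (f x) d
  end.

Definition partial (o : option 'I_n) f : 'rV[R]_n -> R -> R :=
  match o with Some i => Dx i f | None => Dt f end.

Definition jcont O f := forall x t, O t ->
  (fun p : 'rV[R]_n * R => f p.1 p.2) z @[z --> (x, t)] --> f x t.

(** Derivatives are existential witnesses, so closure under sums, products and composition is proved
    by exhibiting formulas. Only the times are restricted to a set [O], because all case
    distinctions of the construction are in time. *)
Fixpoint Ck_on O (k : nat) f : Prop :=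
  match k with
  | 0%N => jcont O f
  | k'.+1 => jcont O f /\ forall o, exists2 g,
      (forall x t, O t -> is_partial o f x t (g x t)) & Ck_on O k' g
  end.

Lemma is_partialE o f x t d : is_partial o f x t d -> partial o f x t = d.
Proof. by case: o => [i|] [_ <-]. Qed.

Lemma is_partial_local o f g x t d O : open O -> O t ->
  (forall y s, O s -> f y s = g y s) -> is_partial o g x t d -> is_partial o f x t d.
Proof.
move=> oO Ot fg; case: o => [i|] /=.
  by have -> : (fun y => f y t) = (fun y => g y t) by apply/funext => y; exact: fg.
move=> H; apply: near_eq_is_derive H.
have : \forall s \near t, O s by exact: open_nbhs_nbhs.
by apply: filterS => s Os; rewrite fg.
Qed.

Lemma Ck_onW O k f : Ck_on O k.+1 f -> Ck_on O k f.
Proof.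
elim: k f => [|k IH] f; first by case.
move=> [cf Hf]; split => // o; have [g Dg Sg] := Hf o.
by exists g => //; exact: IH.
Qed.

Lemma Ck_on_sub O Q k f : Q `<=` O -> Ck_on O k f -> Ck_on Q k f.
Proof.
move=> sub; elim: k f => [|k IH] f /=; first by move=> cf x t /sub; exact: cf.
move=> [cf Hf]; split => [x t /sub|o]; first exact: cf.
have [g Dg Sg] := Hf o.
by exists g; [move=> x t /sub; exact: Dg | exact: IH].
Qed.

(** Witnesses coming from different time sets [Q] have to be merged; the global one is the total
    operator [partial o f], which equals each local witness on its [Q] by uniqueness of derivatives.
    This serves both the switched kernels and the glueing of the solution. *)
Lemma Ck_on_local O k f :
  (forall t, O t -> exists Q g, [/\ open Q, Q t, Ck_on Q k g &
     forall y s, Q s -> f y s = g y s]) -> Ck_on O k f.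
Proof.
elim: k f => [|k IH] f H.
  move=> x t /H [Q [g [oQ Qt cg fg]]] /=; rewrite fg//.
  apply: cvg_trans (cg x t Qt); apply: near_eq_cvg.
  have : \forall p \near (x, t), Q p.2.
    by apply: (@cvg_snd _ _ (nbhs x) (nbhs t) _); exact: open_nbhs_nbhs.
  by apply: filterS => -[y s] /= Qs; rewrite fg.
split.
  move=> x t /H [Q [g [oQ Qt [cg _] fg]]]; rewrite fg//.
  apply: cvg_trans (cg x t Qt); apply: near_eq_cvg.
  have : \forall p \near (x, t), Q p.2.
    by apply: (@cvg_snd _ _ (nbhs x) (nbhs t) _); exact: open_nbhs_nbhs.
  by apply: filterS => -[y s] /= Qs; rewrite fg.
move=> o; exists (partial o f).
  move=> x t /H [Q [g [oQ Qt [cg Dg] fg]]].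
  have [g' Dg' _] := Dg o.
  have Df := is_partial_local oQ Qt fg (Dg' x t Qt).
  by rewrite (is_partialE Df).
apply: IH => t /H [Q [g [oQ Qt [cg Dg] fg]]].
have [g' Dg' Sg'] := Dg o.
exists Q, g'; split => // y s Qs.
exact: is_partialE (is_partial_local oQ Qs fg (Dg' y s Qs)).
Qed.

Lemma Ck_on_eq O k f g : open O -> Ck_on O k g ->
  (forall y s, O s -> f y s = g y s) -> Ck_on O k f.
Proof. by move=> oO Sg fg; apply: Ck_on_local => t Ot; exists O, g; split. Qed.

Lemma Ck_on_Ck k f : Ck_on [set t : R | 0 < t < 1] k f -> Ck k f.
Proof.
have oO : open [set t : R | 0 < t < 1].
  rewrite (_ : [set t : R | 0 < t < 1] = `]0, 1[%classic).
    exact: interval_open.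
  by apply/funext => t; rewrite /= in_itv.
elim: k f => [|k IH] f; first by move=> cf x t; exact: cf.
move=> [cf Hf].
have aux o : (forall x t, 0 < t < 1 -> is_partial o f x t (partial o f x t)) /\
    Ck_on [set t : R | 0 < t < 1] k (partial o f).
  have [g Dg Sg] := Hf o; split => [x t Ht|].
    by rewrite (is_partialE (Dg x t Ht)); exact: Dg.
  by apply: Ck_on_eq Sg _ => // y s Hs; apply: is_partialE; exact: Dg.
split; [exact: cf|split => [x t Ht|]].
  split => [i|]; first by have [/(_ x t Ht) [] ] := aux (Some i).
  by have [/(_ x t Ht) [] ] := aux None.
by split => [i|]; apply: IH; [have [] := aux (Some i)|have [] := aux None].
Qed.

Lemma Ck_on_cst O k (c : R) : Ck_on O k (fun _ _ => c).
Proof.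
elim: k c => [|k IH] c; first by move=> x t _; exact: cvg_cst.
split=> [x t _|o]; first exact: cvg_cst.
by exists (fun _ _ => 0) => // x t _; case: o => [i|]; exact: is_derive_cst.
Qed.

Lemma Ck_on_t O k : Ck_on O k (fun _ t => t).
Proof.
have c : jcont O (fun _ t => t) by move=> x t _; exact: cvg_snd.
case: k => [|k]; first exact: c.
split=> [//|[i|]].
  by exists (fun _ _ => 0); [move=> x t _; exact: is_derive_cst|exact: Ck_on_cst].
by exists (fun _ _ => 1); [move=> x t _; exact: is_derive_id|exact: Ck_on_cst].
Qed.

Lemma Ck_on_coord O k (j : 'I_n) : Ck_on O k (fun x _ => x ord0 j).
Proof.
have c : jcont O (fun x _ => x ord0 j).
  move=> x t _ /=.
  apply: (@cvg_comp _ _ _ (fun p : 'rV[R]_n * R => p.1) (fun y : 'rV[R]_n => y ord0 j) _ (nbhs x)).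
    exact: cvg_fst.
  exact: coord_continuous.
case: k => [|k]; first exact: c.
split=> [//|[i|]].
  exists (fun _ _ => (j == i)%:R); [move=> x t _|exact: Ck_on_cst].
  apply: is_derive_line => /=.
  rewrite (_ : (fun h : R => (h *: delta_mx ord0 i + x) ord0 j) =
     (fun h => h * (j == i)%:R + x ord0 j)); last first.
    by apply/funext => h; rewrite !mxE /=.
  apply: is_derive_eq; rewrite addr0 scaler0 add0r.
  by rewrite /GRing.scale /= mulr1.
by exists (fun _ _ => 0); [move=> x t _; exact: is_derive_cst|exact: Ck_on_cst].
Qed.

Lemma Ck_onD O k f g : Ck_on O k f -> Ck_on O k g -> Ck_on O k (fun x t => f x t + g x t).
Proof.
elim: k f g => [|k IH] f g; first by move=> cf cg x t Ot; exact: cvgD (cf _ _ _) (cg _ _ _).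
move=> [cf Hf] [cg Hg]; split => [x t Ot|o].
  exact: cvgD (cf _ _ _) (cg _ _ _).
have [f' Df Sf] := Hf o; have [g' Dg Sg] := Hg o.
exists (fun x t => f' x t + g' x t); last exact: IH.
move=> x t Ot; move: (Df x t Ot) (Dg x t Ot).
by case: o {Df Dg Hf Hg} => [i|]; exact: is_deriveD.
Qed.

Lemma Ck_onM O k f g : Ck_on O k f -> Ck_on O k g -> Ck_on O k (fun x t => f x t * g x t).
Proof.
elim: k f g => [|k IH] f g; first by move=> cf cg x t Ot; exact: cvgM (cf _ _ _) (cg _ _ _).
move=> Sf Sg; have /Ck_onW Wf := Sf; have /Ck_onW Wg := Sg.
move: Sf Sg => [cf Hf] [cg Hg]; split => [x t Ot|o].
  exact: cvgM (cf _ _ _) (cg _ _ _).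
have [f' Df Sf] := Hf o; have [g' Dg Sg] := Hg o.
exists (fun x t => f x t * g' x t + g x t * f' x t); last by apply: Ck_onD; exact: IH.
move=> x t Ot; move: (Df x t Ot) (Dg x t Ot).
by case: o {Df Dg Hf Hg} => [i|] H1 H2; exact: is_deriveM.
Qed.

Lemma Ck_on_sum O k (N : nat) (F : nat -> 'rV[R]_n -> R -> R) :
  (forall i, (i < N)%N -> Ck_on O k (F i)) ->
  Ck_on O k (fun x t => \sum_(i < N) F i x t).
Proof.
elim: N => [|N IH] H.
  rewrite (_ : (fun _ _ => _) = (fun _ _ => 0)); first exact: Ck_on_cst.
  by apply/funext => x; apply/funext => t; rewrite big_ord0.
rewrite (_ : (fun _ _ => _) = (fun x t => \sum_(i < N) F i x t + F N x t)).
  by apply: Ck_onD; [apply: IH => i iN; apply: H; exact: leqW | exact: H].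
by apply/funext => x; apply/funext => t; rewrite big_ord_recr.
Qed.

(** [G k] is the [k]-th derivative of [G 0]. Keeping the whole sequence lets the induction in
    [Ck_on_comp] pass from [G m] to [G m.+1] with the same inner function. *)
Definition tower (A : set R) (G : nat -> R -> R) : Prop :=
  forall k y, A y -> is_derive y 1 (G k) (G k.+1 y).

Lemma Ck_on_comp O k f A G : tower A G -> Ck_on O k f ->
  (forall x t, O t -> A (f x t)) -> forall m, Ck_on O k (fun x t => G m (f x t)).
Proof.
move=> TG; elim: k f => [|k IH] f Sf Af m.
  move=> x t Ot; apply: (@cvg_comp _ _ _ (fun p : 'rV[R]_n * R => f p.1 p.2) (G m) _ (nbhs (f x t))).
    exact: Sf.
  have [dG _] := TG m _ (Af x t Ot).
  exact: (differentiable_continuous ((derivable1_diffP (G m) (f x t)).1 dG)).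
have /Ck_onW Wf := Sf; case: Sf => cf Hf; split => [x t Ot|o].
  apply: (@cvg_comp _ _ _ (fun p : 'rV[R]_n * R => f p.1 p.2) (G m) _ (nbhs (f x t))).
    exact: cf.
  have [dG _] := TG m _ (Af x t Ot).
  exact: (differentiable_continuous ((derivable1_diffP (G m) (f x t)).1 dG)).
have [f' Df Sf] := Hf o.
exists (fun x t => G m.+1 (f x t) * f' x t); last by apply: Ck_onM => //; exact: IH.
move=> x t Ot; have := Df x t Ot; have := TG m _ (Af x t Ot).
by case: o {Df Hf} => [i|] H1 H2; exact: is_derive_comp_dir.
Qed.

End smoothness.

(** * The heat operator *)

Section heat_operator.
Set Implicit Arguments.
Unset Strict Implicit.
Context {R : realType} {n : nat}.
Implicit Types (f g : 'rV[R]_n -> R -> R) (x : 'rV[R]_n) (t : R).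

(** A certificate for the value of the heat operator. The first space derivatives [p i] are demanded
    at every [y], since [q i] is a derivative of the function [p i]. Certificates combine by linear
    rules, and [is_heatE] returns to [Dt] and [lap]. *)
Definition is_heat f x t (h : R) : Prop :=
  exists d (p : 'I_n -> 'rV[R]_n -> R) (q : 'I_n -> R),
  [/\ is_derive t 1 (f x) d,
      forall i y, is_derive y (delta_mx ord0 i) (fun y => f y t) (p i y),
      forall i, is_derive x (delta_mx ord0 i) (p i) (q i) &
      h = d - \sum_(i < n) q i].

Lemma is_heatE f x t h : is_heat f x t h -> Dt f x t - lap f x t = h.
Proof.
move=> [d [p [q [[_ Hd] Hp Hq ->]]]]; rewrite /Dt Hd /lap; congr (_ - _).
apply: eq_bigr => i _; rewrite /Dx.
have -> : (fun y => 'D_(delta_mx ord0 i) (fun y0 => f y0 t) y) = p i.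
  by apply/funext => y; have [] := Hp i y.
by have [] := Hq i.
Qed.

Lemma is_heat_local f g x t h (O : set R) : open O -> O t ->
  (forall y s, O s -> f y s = g y s) -> is_heat g x t h -> is_heat f x t h.
Proof.
move=> oO Ot fg [d [p [q [Hd Hp Hq ->]]]]; exists d, p, q; split => //.
- exact: (@is_partial_local _ _ None f g x t d O oO Ot fg Hd).
- move=> i y; exact: (@is_partial_local _ _ (Some i) f g y t _ O oO Ot fg (Hp i y)).
Qed.

Lemma is_heatD f g x t h k : is_heat f x t h -> is_heat g x t k ->
  is_heat (fun x t => f x t + g x t) x t (h + k).
Proof.
move=> [d [p [q [Hd Hp Hq ->]]]] [d' [p' [q' [Hd' Hp' Hq' ->]]]].
exists (d + d'), (fun i y => p i y + p' i y), (fun i => q i + q' i); split.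
- exact: is_deriveD.
- by move=> i y; have := Hp i y; have := Hp' i y => ? ?; exact: is_deriveD.
- by move=> i; have := Hq i; have := Hq' i => ? ?; exact: is_deriveD.
- by rewrite big_split /= opprD addrACA.
Qed.

Lemma is_heatM_time (a : R -> R) (a' : R) f x t h :
  is_derive t 1 a a' -> is_heat f x t h ->
  is_heat (fun x t => a t * f x t) x t (a t * h + a' * f x t).
Proof.
move=> Ha [d [p [q [Hd Hp Hq ->]]]].
exists (a t * d + f x t * a'), (fun i y => a t * p i y), (fun i => a t * q i).
split.
- exact: is_deriveM.
- move=> i y; have ? := Hp i y; exact: is_deriveZ.
- move=> i; have ? := Hq i; exact: is_deriveZ.
- by rewrite -mulr_sumr; ring.
Qed.

Lemma is_heat_cst (c : R) x t : is_heat (fun _ _ => c) x t 0.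
Proof.
exists 0, (fun _ _ => 0), (fun _ => 0); split.
- exact: is_derive_cst.
- move=> i y; exact: is_derive_cst.
- move=> i; exact: is_derive_cst.
- by rewrite big1// subr0.
Qed.

Lemma is_heat_sum (N : nat) (F : nat -> 'rV[R]_n -> R -> R) (h : nat -> R) x t :
  (forall i, (i < N)%N -> is_heat (F i) x t (h i)) ->
  is_heat (fun x t => \sum_(i < N) F i x t) x t (\sum_(i < N) h i).
Proof.
elim: N => [|N IH] H.
  rewrite big_ord0 (_ : (fun _ _ => _) = (fun _ _ => 0)); first exact: is_heat_cst.
  by apply/funext => y; apply/funext => s; rewrite big_ord0.
rewrite big_ord_recr /=.
rewrite (_ : (fun _ _ => _) = (fun x t => \sum_(i < N) F i x t + F N x t)).
  by apply: is_heatD; [apply: IH => i iN; apply: H; exact: leqW | exact: H].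
by apply/funext => y; apply/funext => s; rewrite big_ord_recr.
Qed.

Lemma sqnorm_ge0 x : 0 <= sqnorm x.
Proof. by apply: sumr_ge0 => i _; exact: sqr_ge0. Qed.

Lemma is_derive_inv (y : R) : y != 0 -> is_derive y 1 (fun y : R => y^-1) (- y ^- 2).
Proof.
move=> y0; have dy : derivable (@id R) y 1 by exact: derivable_id.
split; first exact: (derivableV (f := @id R)).
by rewrite (deriveV (f := @id R))// derive_id /GRing.scale /= mulr1.
Qed.

Lemma is_derive_coord x (i j : 'I_n) :
  is_derive x (delta_mx ord0 i) (fun y : 'rV[R]_n => y ord0 j) (j == i)%:R.
Proof.
apply: is_derive_line => /=.
rewrite (_ : (fun h : R => _) = (fun h => h * (j == i)%:R + x ord0 j)).
  apply: is_derive_eq; rewrite addr0 scaler0 add0r.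
  by rewrite /GRing.scale /= mulr1.
by apply/funext => h; rewrite !mxE /=.
Qed.

Lemma is_derive_sqnorm x (i : 'I_n) :
  is_derive x (delta_mx ord0 i) (@sqnorm R n) (2 * x ord0 i).
Proof.
have H (j : 'I_n) : is_derive x (delta_mx ord0 i)
    (fun y : 'rV[R]_n => y ord0 j ^+ 2) ((2 * x ord0 j) * (j == i)%:R).
  have H := is_derive_coord x i j.
  apply: (@is_derive_comp_dir _ _ (fun y : 'rV[R]_n => y ord0 j) (fun a => a ^+ 2)) => //.
  by apply: is_derive_eq; rewrite /GRing.scale /=; ring.
have S := is_derive_sum H.
have -> : (@sqnorm R n) = \sum_(j < n) (fun y : 'rV[R]_n => y ord0 j ^+ 2).
  by apply/funext => y; rewrite fct_sumE.
apply: is_derive_eq; rewrite (bigD1 i)//= eqxx mulr1 big1 ?addr0// => j /negPf ->.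
by rewrite mulr0.
Qed.

(** Chain rule with [tau = t - s0]: the gradient of [z] has square [4 (z - 1)/tau], its Laplacian is
    [2 n/tau] and its time derivative [-(z - 1)/tau]. *)
Lemma is_heat_selfsimilar (s s0 : R) (F F1 F2 : R -> R) x t :
  (forall z : R, 0 < z -> is_derive z 1 F (F1 z)) ->
  (forall z : R, 0 < z -> is_derive z 1 F1 (F2 z)) -> s0 < t ->
  let z := 1 + sqnorm x / (t - s0) in
  is_heat (fun x t => (t - s0) `^ (- s) * F (1 + sqnorm x / (t - s0))) x t
    (- (t - s0) `^ (- s - 1) *
       (4 * (z - 1) * F2 z + (2 * n%:R + z - 1) * F1 z + s * F z)).
Proof.
move=> HF HF1 st z.
have tau0 : 0 < t - s0 by rewrite subr_gt0.
have tau_neq0 : t - s0 != 0 by rewrite gt_eqF.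
have zp (y : 'rV[R]_n) : 0 < 1 + sqnorm y / (t - s0).
  by rewrite ltr_wpDr// divr_ge0 ?sqnorm_ge0// ltW.
have Hz (y : 'rV[R]_n) i : is_derive y (delta_mx ord0 i)
    (fun y => 1 + sqnorm y / (t - s0)) ((t - s0)^-1 * (2 * y ord0 i)).
  have H := is_derive_sqnorm y i.
  apply: (@is_derive_comp_dir _ _ (@sqnorm R n) (fun a => 1 + a / (t - s0))
     y _ (2 * y ord0 i) (t - s0)^-1 H).
  by apply: is_derive_eq; rewrite /GRing.scale /=; ring.
pose N := sqnorm x.
have Ht0 : is_derive t 1 (fun t : R => t - s0) 1.
  by apply: is_derive_eq; rewrite /GRing.scale /=; ring.
have Ht1 : is_derive t 1 (fun t : R => (t - s0) `^ (- s)) (- s * (t - s0) `^ (- s - 1) * 1).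
  exact: (is_derive_comp_dir Ht0 (is_derive1_powR (- s) tau0)).
have Ht2 : is_derive t 1 (fun t : R => 1 + N / (t - s0)) (- N / (t - s0) ^+ 2 * 1).
  apply: (is_derive_comp_dir (G := fun a => 1 + N / a) Ht0).
  have Hi := is_derive_inv tau_neq0.
  by apply: is_derive_eq; rewrite /GRing.scale /=; field.
have Ht3 := is_derive_comp_dir Ht2 (HF _ (zp x)).
pose T := (t - s0) `^ (- s).
exists ((t - s0) `^ (- s) * (F1 (1 + sqnorm x / (t - s0)) * (- N / (t - s0) ^+ 2 * 1))
     + F (1 + sqnorm x / (t - s0)) * (- s * (t - s0) `^ (- s - 1) * 1)),
  (fun i y => T * (F1 (1 + sqnorm y / (t - s0)) * ((t - s0)^-1 * (2 * y ord0 i)))),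
  (fun i => T * (F1 z * ((t - s0)^-1 * 2) + ((t - s0)^-1 * (2 * x ord0 i)) * (F2 z * ((t - s0)^-1 * (2 * x ord0 i))))).
split.
- exact: is_deriveM.
- move=> i y; have H := is_derive_comp_dir (Hz y i) (HF _ (zp y)).
  exact: is_deriveZ.
- move=> i; have H := is_derive_comp_dir (Hz x i) (HF1 _ (zp x)).
  have H2 : is_derive x (delta_mx ord0 i)
      (fun y : 'rV[R]_n => (t - s0)^-1 * (2 * y ord0 i)) ((t - s0)^-1 * 2).
    have H3 := is_derive_coord x i i.
    apply: is_derive_eq; rewrite eqxx /GRing.scale /=; ring.
  have H4 := is_deriveM H H2.
  exact: is_deriveZ.
- have -> : (t - s0) `^ (- s - 1) = T / (t - s0).
    by rewrite powRB ?powRr1 ?(ltW tau0)//; apply/implyP.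
  rewrite -mulr_sumr big_split /= sumr_const card_ord.
  have -> : \sum_(i < n) (t - s0)^-1 * (2 * x ord0 i) * (F2 z * ((t - s0)^-1 * (2 * x ord0 i)))
     = 4 * F2 z * (t - s0)^-1 ^+ 2 * N.
    rewrite /N /sqnorm mulr_sumr; apply: eq_bigr => i _; ring.
  rewrite -/z -mulr_natl.
  have -> : N = (z - 1) * (t - s0) by rewrite /z -/N; field.
  by rewrite -/T; field.
Qed.

End heat_operator.

(** * Towers of derivatives and a smooth cutoff *)

Section towers.
Set Implicit Arguments.
Unset Strict Implicit.
Context {R : realType}.

Lemma powR_tower (a : R) :
  tower [set y : R | 0 < y] (fun k y => (\prod_(j < k) (a - j%:R)) * y `^ (a - k%:R)).
Proof.
move=> k y /= y0; have H := is_derive1_powR (a - k%:R) y0.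
rewrite big_ord_recr /= -addn1 natrD.
by apply: is_derive_eq; rewrite /GRing.scale /= opprD addrA mulrA.
Qed.

Lemma exprn_le_expR (k : nat) (z : R) : 0 <= z -> z ^+ k <= k`!%:R * expR z.
Proof.
move=> z0; case: k => [|k].
  by rewrite expr0 fact0 mul1r (le_trans _ (expR_ge1Dx z))// lerDl.
have /le_trans := expR_ge1Dxn k z0 => H.
have f0 : (0 : R) < (k.+1)`!%:R by rewrite ltr0n fact_gt0.
rewrite mulrC -ler_pdivrMr//; apply: le_trans (expR_ge1Dxn k z0).
by rewrite lerDr.
Qed.

Lemma horner_le_expR (P : {poly R}) :
  exists2 C, 0 <= C & forall z, 0 <= z -> `|P.[z]| <= C * expR z.
Proof.
exists (\sum_(i < size P) `|P`_i| * i`!%:R).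
  by apply: sumr_ge0 => i _; rewrite mulr_ge0.
move=> z z0; rewrite horner_coef (le_trans (ler_norm_sum _ _ _))//.
rewrite mulr_suml; apply: ler_sum => i _.
rewrite normrM (ger0_norm (exprn_ge0 _ z0)) -mulrA ler_wpM2l//.
exact: exprn_le_expR.
Qed.

(** A class closed under differentiation that contains the classical flat function [exp(-1/x)] (case
    [P = 1]) and all its derivatives. *)
Definition flat (P : {poly R}) (x : R) : R :=
  if 0 < x then P.[x^-1] * expR (- x^-1) else 0.

(** The exponential beats [P(z) z^2] at [z = 1/x]. A quadratic bound makes the difference quotients
    at the origin tend to zero in [flat_derive]. *)
Lemma flat_le (P : {poly R}) : exists2 C, 0 <= C & forall x, `|flat P x| <= C * x ^+ 2.
Proof.
have [C C0 HC] := horner_le_expR (P * 'X^2); exists C => // x.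
rewrite /flat; case: ifPn => [x0|_]; last by rewrite normr0 mulr_ge0// sqr_ge0.
have z0 : 0 <= x^-1 by rewrite invr_ge0 ltW.
have := HC _ z0; rewrite hornerM hornerXn normrM.
rewrite (ger0_norm (exprn_ge0 2 z0)) exprVn.
rewrite normrM (ger0_norm (expR_ge0 _)) expRN => H.
rewrite ler_pdivrMr ?expR_gt0// mulrAC -ler_pdivrMr ?exprn_gt0//.
Qed.

Lemma flat_derive (P : {poly R}) (x : R) :
  is_derive x 1 (flat P) (flat ('X^2 * (P - P^`())) x).
Proof.
rewrite {2}/flat; case: ltgtP => x0.
- have xn0 : x != 0 by rewrite gt_eqF.
  have H1 := is_derive_inv xn0.
  have H2 := is_derive_comp_dir H1 (is_derive_poly P x^-1).
  have H3 := is_derive_comp_dir (is_deriveN H1) (is_derive_expR (- x^-1)).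
  have H4 := is_deriveM H2 H3.
  apply: (@near_eq_is_derive R R^o R^o (fun y => P.[y^-1] * expR (- y^-1)) (flat P) x 1).
    near=> y; rewrite /flat ifT//.
    by near: y; exact: lt_nbhsr.
  apply: is_derive_eq; rewrite !hornerE /GRing.scale /=.
  rewrite exprVn; ring.
- apply: (@near_eq_is_derive R R^o R^o (cst 0) (flat P) x 1).
  near=> y; rewrite /flat ifF//; apply/negbTE; rewrite -leNgt; apply: ltW.
  by near: y; exact: lt_nbhsl.
- have [C C0 HC] := flat_le P.
  have H : h^-1 *: (flat P (h *: 1 + x) - flat P x) @[h --> 0^'] --> (0 : R).
    apply/cvgr0Pnorm_lt => e e0.
    have d0 : 0 < e / (C + 1) by rewrite divr_gt0// ltr_wpDl.
    near=> h.
    have hn0 : h != 0 by near: h; exact: nbhs_dnbhs_neq.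
    have f0 : flat P x = 0 by rewrite /flat -x0 ltxx.
    rewrite f0 subr0 -x0 addr0 /GRing.scale /= mulr1 normrM normfV.
    have h0 : 0 < `|h| by rewrite normr_gt0.
    rewrite mulrC ltr_pdivrMr//; apply: le_lt_trans (HC h) _.
    rewrite -real_normK ?num_real// expr2 mulrA ltr_pM2r//.
    have : `|h| < e / (C + 1).
      near: h; apply: dnbhs0_lt => //.
    rewrite ltr_pdivlMr ?ltr_wpDl// => H; apply: le_lt_trans H.
    by rewrite mulrC ler_wpM2l// lerDl.
  split; first by apply/cvg_ex; exists 0.
  exact: cvg_lim.
Unshelve. all: by end_near. Qed.

Fixpoint flat_poly (k : nat) : {poly R} :=
  if k is k'.+1 then 'X^2 * (flat_poly k' - (flat_poly k')^`()) else 1.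

Lemma flat_tower (A : set R) : tower A (fun k => flat (flat_poly k)).
Proof. by move=> k y _; exact: flat_derive. Qed.

End towers.

Section cutoff.
Set Implicit Arguments.
Unset Strict Implicit.
Context {R : realType}.

Let g : R -> R := flat (flat_poly 0).
Let g' : R -> R := flat (flat_poly 1).

Let g_ge0 (x : R) : 0 <= g x.
Proof. by rewrite /g /flat; case: ifP => // _; rewrite hornerC mul1r expR_ge0. Qed.

Let g_le1 (x : R) : g x <= 1.
Proof.
rewrite /g /flat; case: ifP => // x0; rewrite hornerC mul1r expR_le1.
by rewrite oppr_le0 invr_ge0 ltW.
Qed.

Let g_le0 (x : R) : x <= 0 -> g x = 0.
Proof. by move=> x0; rewrite /g /flat ltNge x0. Qed.

Let g_half (x : R) : 2^-1 <= x -> expR (- 2) <= g x.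
Proof.
move=> x2; have x0 : 0 < x by apply: lt_le_trans x2.
rewrite /g /flat x0 hornerC mul1r ler_expR lerN2 -[leRHS]invrK lef_pV2 ?posrE//.
Qed.

Let g'E (x : R) : g' x = if 0 < x then x^-1 ^+ 2 * expR (- x^-1) else 0.
Proof. by rewrite /g' /flat /= derivC subr0 mulr1 hornerXn. Qed.

Let g'_ge0 (x : R) : 0 <= g' x.
Proof. by rewrite g'E; case: ifP => // _; rewrite mulr_ge0 ?sqr_ge0 ?expR_ge0. Qed.

Let g'_le2 (x : R) : g' x <= 2.
Proof.
rewrite g'E; case: ifP => // x0; rewrite expRN ler_pdivrMr ?expR_gt0//.
by apply: (@exprn_le_expR R 2); rewrite invr_ge0 ltW.
Qed.

Let g'_le0 (x : R) : x <= 0 -> g' x = 0.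
Proof. by move=> x0; rewrite g'E ltNge x0. Qed.

Let den (y : R) := g (y - 1) + g (2 - y).

Let den_ge (y : R) : expR (- 2) <= den y.
Proof.
case: (leP (3 / 2) y) => H.
  by rewrite (le_trans (@g_half (y - 1) _)) ?lerDl//; lra.
by rewrite (le_trans (@g_half (2 - y) _)) ?lerDr//; lra.
Qed.

Let den_gt0 (y : R) : 0 < den y.
Proof. exact: lt_le_trans (expR_gt0 _) (den_ge y). Qed.

Definition chi (y : R) : R := g (y - 1) / (g (y - 1) + g (2 - y)).

Definition dchi (y : R) : R :=
  (g' (y - 1) * g (2 - y) + g (y - 1) * g' (2 - y)) / (g (y - 1) + g (2 - y)) ^+ 2.

Lemma chi_ge0 (y : R) : 0 <= chi y.
Proof. by rewrite divr_ge0// addr_ge0. Qed.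

Lemma chi_le1 (y : R) : chi y <= 1.
Proof. by rewrite ler_pdivrMr ?den_gt0// mul1r lerDl. Qed.

Lemma chi_eq0 (y : R) : y <= 1 -> chi y = 0.
Proof. by move=> y1; rewrite /chi g_le0 ?mul0r// subr_le0. Qed.

Lemma chi_eq1 (y : R) : 2 <= y -> chi y = 1.
Proof.
move=> y2; rewrite /chi (@g_le0 (2 - y)) ?addr0 ?subr_le0// divff//.
by have := den_gt0 y; rewrite /den (@g_le0 (2 - y)) ?addr0 ?subr_le0// => /gt_eqF ->.
Qed.

Lemma is_derive_chi (y : R) : is_derive y 1 chi (dchi y).
Proof.
have dn : den y != 0 by rewrite gt_eqF.
have H1 : is_derive y 1 (fun y : R => g (y - 1)) (g' (y - 1) * 1).
  apply: is_derive_comp_dir; last exact: (@flat_tower R setT 0%N).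
  by apply: is_derive_eq; rewrite subr0.
have H2 : is_derive y 1 (fun y : R => g (2 - y)) (g' (2 - y) * (- 1)).
  apply: is_derive_comp_dir; last exact: (@flat_tower R setT 0%N).
  by apply: is_derive_eq; ring.
have H3 := is_deriveD H1 H2.
have H4 := is_derive_comp_dir H3 (is_derive_inv dn).
have H5 := is_deriveM H1 H4.
apply: (is_derive_eq H5); rewrite /dchi /GRing.scale /= fctE.
have dn' : g (y - 1) + g (2 - y) != 0 by [].
by rewrite /den; field.
Qed.

Lemma dchi_ge0 (y : R) : 0 <= dchi y.
Proof. by rewrite divr_ge0 ?sqr_ge0// addr_ge0// mulr_ge0. Qed.

Lemma dchi_le : exists2 C : R, 0 < C & forall y, dchi y <= C.
Proof.
exists (4 * expR 4) => [|y]; first by rewrite mulr_gt0 ?expR_gt0.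
rewrite ler_pdivrMr ?exprn_gt0 ?den_gt0//.
have E : expR (- 4) <= den y ^+ 2.
  rewrite (_ : - 4 = (- 2) + (- 2)); last by lra.
  by rewrite expRD expr2 ler_pM ?expR_ge0.
have H : 4 <= 4 * expR 4 * den y ^+ 2.
  rewrite -mulrA -[leLHS]mulr1 ler_wpM2l//.
  have := expRxMexpNx_1 (4 : R); move=> {1}<-.
  by apply: ler_wpM2l => //; exact: expR_ge0.
apply: le_trans H.
have -> : (4 : R) = 2 * 1 + 1 * 2 by lra.
by apply: lerD; apply: ler_pM.
Qed.

Lemma dchi_eq0 (y : R) : (y <= 1) || (2 <= y) -> dchi y = 0.
Proof.
move=> /orP[y1|y2]; rewrite /dchi.
  by rewrite (@g'_le0 (y - 1)) ?(@g_le0 (y - 1)) ?subr_le0// !mul0r addr0 mul0r.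
by rewrite (@g'_le0 (2 - y)) ?(@g_le0 (2 - y)) ?subr_le0// !mulr0 addr0 mul0r.
Qed.

Lemma Ck_on_chi n (O : set R) k (f : 'rV[R]_n -> R -> R) :
  Ck_on O k f -> Ck_on O k (fun x t => chi (f x t)).
Proof.
move=> Sf.
have S1 : Ck_on O k (fun x t => g (f x t - 1)).
  apply: (Ck_on_comp (@flat_tower R setT) (f := fun x t => f x t - 1)) => //.
  by apply: Ck_onD => //; exact: Ck_on_cst.
have S2 : Ck_on O k (fun x t => g (2 - f x t)).
  apply: (Ck_on_comp (@flat_tower R setT) (f := fun x t => 2 - f x t)) => //.
  apply: Ck_onD; first exact: Ck_on_cst.
  rewrite (_ : (fun x t => - f x t) = (fun x t => -1 * f x t)).
    by apply: Ck_onM => //; exact: Ck_on_cst.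
  by apply/funext => x; apply/funext => t; rewrite mulN1r.
have S3 := Ck_on_comp (powR_tower (-1)) (Ck_onD S1 S2) (fun x t _ => den_gt0 (f x t)) 0%N.
have := Ck_onM S1 S3; congr (Ck_on O k _).
apply/funext => x; apply/funext => t; rewrite big_ord0 mul1r subr0 powR_inv1//.
exact/ltW/den_gt0.
Qed.

End cutoff.

(** * The self-similar background *)

Section profile.
Set Implicit Arguments.
Unset Strict Implicit.
Context {R : realType}.
Implicit Types (G : nat -> R -> R) (A : set R) (z : R).

Lemma expR_decay (d k : R) : 0 < d ->
  exists2 C : R, 0 < C & forall z, 1 <= z -> expR (- (d * z)) <= C * z `^ (- k).
Proof.
move=> d0; pose N := Num.truncn `|k|.
have kN : k <= N.+1%:R.
  by rewrite (le_trans (ler_norm k))// ltW// truncnS_gt.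
exists (N.+1`!%:R * d ^- N.+1) => [|z z1].
  by rewrite mulr_gt0 ?invr_gt0 ?exprn_gt0// ltr0n fact_gt0.
have z0 : 0 < z by apply: lt_le_trans z1.
rewrite expRN powRN ler_pdivlMr ?powR_gt0// mulrC ler_pdivrMr ?expR_gt0//.
apply: (@le_trans _ _ (z ^+ N.+1)).
  by rewrite -powR_mulrn ?(ltW z0)// ler_powR.
rewrite mulrAC ler_pdivlMr ?exprn_gt0// -exprMn (mulrC z).
by apply: exprn_le_expR; rewrite mulr_ge0 ?ltW.
Qed.

Lemma towerD A G G' : tower A G -> tower A G' ->
  tower A (fun k z => G k z + G' k z).
Proof. by move=> H H' k y Ay; have ? := H k y Ay; have ? := H' k y Ay; exact: is_deriveD. Qed.

Lemma towerZ A (c : R) G : tower A G -> tower A (fun k z => c * G k z).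
Proof. by move=> H k y Ay; have ? := H k y Ay; exact: is_deriveZ. Qed.

Definition gauss_tower (k : nat) (z : R) : R := (- 4^-1) ^+ k * expR (- ((z - 1) / 4)).

Lemma gauss_towerP A : tower A gauss_tower.
Proof.
move=> k y _; rewrite /gauss_tower.
have H : is_derive y 1 (fun z : R => - ((z - 1) / 4)) (- 4^-1).
  by apply: is_derive_eq; rewrite /GRing.scale /=; ring.
have H1 := is_derive_comp_dir H (is_derive_expR (- ((y - 1) / 4))).
have H2 := is_deriveZ ((- 4^-1) ^+ k) H1.
by apply: (is_derive_eq H2); rewrite /GRing.scale /= exprS; ring.
Qed.

Definition pow_tower (a : R) (k : nat) (y : R) : R :=
  (\prod_(j < k) (a - j%:R)) * y `^ (a - k%:R).

Section operator.
Variables (n : nat) (s : R).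

(* [t `^ (- s) * F (1 + |x|^2 / t)] is mapped by the heat operator to
   [t `^ (- s - 1) * ssheat F (1 + |x|^2 / t)] *)
Definition ssheat G z : R :=
  - (4 * (z - 1) * G 2%N z + (2 * n%:R + z - 1) * G 1%N z + s * G 0%N z).

Lemma ssheatD G G' z : ssheat (fun k z => G k z + G' k z) z = ssheat G z + ssheat G' z.
Proof. by rewrite /ssheat; ring. Qed.

Lemma ssheatZ (c : R) G z : ssheat (fun k z => c * G k z) z = c * ssheat G z.
Proof. by rewrite /ssheat; ring. Qed.

(** The Gaussian profile is that of the heat kernel, so the factor vanishes for [s = n/2]. It is
    positive for [s < n/2], and a large multiple then repairs the sign of any source on a bounded
    range of [z]. *)
Lemma ssheat_gauss z : ssheat gauss_tower z = (n%:R / 2 - s) * gauss_tower 0 z.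
Proof. by rewrite /ssheat /gauss_tower; field. Qed.

Lemma ssheat_pow (k : R) z : 0 < z -> ssheat (pow_tower (- k)) z =
  (k - s) * z `^ (- k) - k * (4 * (k + 1) - (2 * n%:R - 1)) * z `^ (- k - 1)
    + 4 * k * (k + 1) * z `^ (- k - 2).
Proof.
move=> z0; rewrite /ssheat /pow_tower !big_ord_recr !big_ord0 /= !subr0 !mul1r.
have zn0 : z != 0 by rewrite gt_eqF.
have E1 : z `^ (- k - 1) = z `^ (- k) / z.
  by rewrite powRB ?powRr1 ?(ltW z0)//; apply/implyP.
have E2 : z `^ (- k - 2) = z `^ (- k) / z ^+ 2.
  by rewrite powRB ?powR_mulrn ?(ltW z0)//; apply/implyP.
by rewrite E1 E2; field.
Qed.

(** Expansion of a self-similar solution in powers of [1/z]. By [ssheat_pow] the power [z^{-k}]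
    produces [(k - s) z^{-k}] plus faster decaying terms. So [z^{-s}] has no leading term, and a
    multiple of the next power [k = s + m + 1] cancels the current coefficient [a], gaining one
    order of decay. *)
Lemma poly_profile (m : nat) : exists G a b C,
  [/\ tower [set z : R | 0 < z] G,
      0 <= C, (forall z, 1 <= z -> `|G 0%N z - z `^ (- s)| <= C * z `^ (- s - 1)) &
      forall z, 0 < z -> ssheat G z = a * z `^ (- s - m%:R - 1) + b * z `^ (- s - m%:R - 2)].
Proof.
elim: m => [|m [G [a [b [C [TG C0 HC HG]]]]]].
  exists (pow_tower (- s)), (- (s * (4 * (s + 1) - (2 * n%:R - 1)))), (4 * s * (s + 1)), 0.
  split => //; first exact: powR_tower.
    by move=> z z1; rewrite /pow_tower big_ord0 mul1r subr0 subrr normr0 mul0r.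
  by move=> z z0; rewrite ssheat_pow// subrr mul0r add0r subr0 mulNr.
pose k := s + m%:R + 1; pose c := - a / m.+1%:R.
have m0 : (m.+1%:R : R) != 0 by rewrite pnatr_eq0.
exists (fun i z => G i z + c * pow_tower (- k) i z),
  (b - c * (k * (4 * (k + 1) - (2 * n%:R - 1)))), (c * (4 * k * (k + 1))), (C + `|c|).
split.
- exact: towerD TG (towerZ _ (powR_tower _)).
- by rewrite addr_ge0.
- move=> z z1; rewrite addrAC (le_trans (ler_normD _ _))// mulrDl lerD ?HC//.
  rewrite normrM /pow_tower big_ord0 mul1r subr0 ler_wpM2l// ger0_norm ?powR_ge0//.
  by rewrite ler_powR// /k; have := ler0n R m; lra.
- move=> z z0; rewrite ssheatD ssheatZ HG// ssheat_pow//.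
  have -> : - s - m.+1%:R - 1 = - k - 1 by rewrite /k -natr1; ring.
  have -> : - s - m.+1%:R - 2 = - k - 2 by rewrite /k -natr1; ring.
  have -> : - s - m%:R - 1 = - k by rewrite /k; ring.
  have -> : - s - m%:R - 2 = - k - 1 by rewrite /k; ring.
  have -> : k - s = m.+1%:R by rewrite /k -natr1; ring.
  by rewrite /c; field.
Qed.

(** One more power, with coefficient [mu], sets the leading coefficient of the source to [1] instead
    of [0], which gives positivity for large [z]. A large multiple [L] of the Gaussian gives it on
    the remaining bounded range, and likewise secures the lower bound of the profile itself. *)
Lemma profile (m : nat) : 0 < s -> s < n%:R / 2 -> exists G (c C : R),
  [/\ tower [set z : R | 0 < z] G, 0 < c /\ 0 < C,
      (forall z, 1 <= z -> c * z `^ (- s) <= G 0%N z <= C * z `^ (- s)) &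
      forall z, 1 <= z ->
        c * expR (- ((z - 1) / 4)) <= ssheat G z <= C * z `^ (- s - m%:R)].
Proof.
move=> s0 sn; have [G [a [b [C1 [TG C10 HC HG]]]]] := poly_profile m.
pose k := s + m%:R + 1; pose mu := (1 - a) / m.+1%:R.
have m0 : (m.+1%:R : R) != 0 by rewrite pnatr_eq0.
pose b1 := b - mu * (k * (4 * (k + 1) - (2 * n%:R - 1))).
pose b2 := mu * (4 * k * (k + 1)).
pose P := fun i z => G i z + mu * pow_tower (- k) i z.
pose C2 := C1 + `|mu|; pose B := `|b1| + `|b2|.
have k1 : - k <= - s - 1 by rewrite /k; have := ler0n R m; lra.
have B0 : 0 <= B by rewrite addr_ge0.
have C20 : 0 <= C2 by rewrite addr_ge0.
have TP : tower [set z : R | 0 < z] P.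
  exact: towerD TG (towerZ _ (powR_tower _)).
have P0 z : 1 <= z -> `|P 0%N z - z `^ (- s)| <= C2 * z `^ (- s - 1).
  move=> z1; rewrite /P addrAC (le_trans (ler_normD _ _))// mulrDl lerD ?HC//.
  rewrite normrM /pow_tower big_ord0 mul1r subr0 ler_wpM2l// ger0_norm ?powR_ge0//.
  by rewrite ler_powR.
have HP z : 1 <= z -> `|ssheat P z - z `^ (- k)| <= B * z `^ (- k - 1).
  move=> z1; have z0 : 0 < z by apply: lt_le_trans z1.
  rewrite /P ssheatD ssheatZ HG// ssheat_pow//.
  have -> : - s - m%:R - 1 = - k by rewrite /k; ring.
  have -> : - s - m%:R - 2 = - k - 1 by rewrite /k; ring.
  have -> : k - s = m.+1%:R by rewrite /k -natr1; ring.
  rewrite (_ : _ - _ = b1 * z `^ (- k - 1) + b2 * z `^ (- k - 2)); last first.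
    by rewrite /b1 /b2 /mu; field.
  rewrite (le_trans (ler_normD _ _))// (normrM b1) (normrM b2) /B mulrDl !(ger0_norm (powR_ge0 _ _)).
  apply: lerD => //; apply: ler_wpM2l => //; apply: ler_powR => //; lra.
pose g := n%:R / 2 - s; have g0 : 0 < g by rewrite subr_gt0.
pose E z := expR (- ((z - 1) / 4)) : R.
have E0 z : 0 < E z by exact: expR_gt0.
have Emono z y : z <= y -> E y <= E z by move=> zy; rewrite ler_expR; lra.
have [D1 D10 HD1] := @expR_decay 4^-1 k ltac:(by []).
have ED k' z : 1 <= z -> k' <= k -> E z <= D1 * expR 4^-1 * z `^ (- k').
  move=> z1 k'k.
  rewrite /E (_ : - ((z - 1) / 4) = - (4^-1 * z) + 4^-1); last by field.
  rewrite expRD mulrAC ler_wpM2r ?expR_ge0// (le_trans (HD1 z z1))//.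
  by rewrite ler_wpM2l ?(ltW D10)// ler_powR// lerN2.
(* [L1] covers [z <= 2 C2 + 1], where [z^{-s}] may fail to dominate the error of the profile; [L2]
   covers [z <= B + 1], where the leading power may fail to dominate the error of the source. *)
pose L1 := (C2 + 1) / E (2 * C2 + 1); pose L2 := 1 + B / (g * E (B + 1)).
pose L := L1 + L2.
have L10 : 0 < L1 by rewrite divr_gt0// ltr_wpDl.
have L20 : 1 <= L2 by rewrite lerDl divr_ge0// mulr_ge0// ltW.
have L0 : 0 < L by rewrite addr_gt0// (lt_le_trans _ L20).
pose c := Num.min 2^-1 g.
have c0 : 0 < c by rewrite lt_min invr_gt0 ltr0n g0.
pose D2 := D1 * expR 4^-1; have D20 : 0 < D2 by rewrite mulr_gt0 ?expR_gt0.
exists (fun i z => P i z + L * gauss_tower i z), c, (1 + C2 + B + L * D2 + L * g * D2).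
have powD z a' : 1 <= z -> z `^ (a' - 1) = z `^ a' / z.
  move=> z1; have z0 : 0 < z by apply: lt_le_trans z1.
  by rewrite powRB ?powRr1 ?(ltW z0)//; apply/implyP => _; rewrite gt_eqF.
have g0E z : gauss_tower 0 z = E z by rewrite /gauss_tower expr0 mul1r.
split.
- by apply: towerD => //; apply: towerZ; exact: gauss_towerP.
- split => //; have : 0 < L * D2 by rewrite mulr_gt0.
  have : 0 < L * g * D2 by rewrite !mulr_gt0.
  by move: C20 B0; lra.
- move=> z z1; rewrite g0E; have z0 : 0 < z by apply: lt_le_trans z1.
  have := P0 z z1; rewrite ler_norml => /andP[Pl Pu].
  set p := z `^ (- s) in Pl Pu *; have p0 : 0 < p by rewrite powR_gt0.
  have q0 : z `^ (- s - 1) <= p by rewrite ler_powR//; lra.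
  have p1 : p <= 1 by rewrite -(powRr0 z) ler_powR//; lra.
  have C2q : C2 * z `^ (- s - 1) <= C2 * p by rewrite ler_wpM2l.
  apply/andP; split.
    have cp : c * p <= 2^-1 * p by rewrite ler_pM2r// ge_min lexx.
    apply: le_trans cp _.
    case: (leP (2 * C2 + 1) z) => zC.
      have : C2 * z `^ (- s - 1) <= 2^-1 * p.
        rewrite powD// -/p (_ : C2 * (p / z) = C2 / z * p); last by ring.
        by rewrite ler_pM2r// ler_pdivrMr//; move: zC; lra.
      have : 0 <= L * E z by rewrite mulr_ge0// ltW.
      lra.
    have : C2 + 1 <= L * E z.
      apply: (@le_trans _ _ (L1 * E (2 * C2 + 1))).
        by rewrite /L1 divfK// gt_eqF.
      apply: ler_pM; rewrite ?(ltW L10) ?(ltW (E0 _))//.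
        by rewrite /L lerDl; lra.
      by apply: Emono; exact: ltW.
    have : C2 * p <= C2 by rewrite -[leRHS]mulr1 ler_wpM2l.
    lra.
  have H1 : L * E z <= L * (D2 * p).
    by rewrite ler_pM2l// ED// /k; have := ler0n R m; lra.
  have H2 : 0 <= B * p + L * g * D2 * p.
    by rewrite addr_ge0// !mulr_ge0// ltW.
  lra.
- move=> z z1; have z0 : 0 < z by apply: lt_le_trans z1.
  rewrite ssheatD ssheatZ ssheat_gauss -/g g0E -/(E z).
  have := HP z z1; rewrite ler_norml => /andP[Hl Hu].
  set p := z `^ (- k) in Hl Hu *; have p0 : 0 < p by rewrite powR_gt0.
  have q0 : z `^ (- k - 1) <= p by rewrite ler_powR//; lra.
  have p1 : p <= 1 by rewrite -(powRr0 z) ler_powR// /k; have := ler0n R m; lra.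
  have Bq : B * z `^ (- k - 1) <= B * p by rewrite ler_wpM2l.
  apply/andP; split.
    have cp : c * E z <= g * E z by rewrite ler_pM2r// ge_min lexx orbT.
    apply: le_trans cp _.
    case: (leP (B + 1) z) => zB.
      have : B * z `^ (- k - 1) <= p.
        rewrite powD// -/p mulrCA -[leRHS]mulr1 ler_pM2l// ler_pdivrMr//.
        by move: zB; lra.
      have : g * E z <= L * (g * E z).
        by rewrite -[leLHS]mul1r ler_pM2r ?mulr_gt0// (le_trans L20)// lerDr ltW.
      lra.
    have H : g * E z + B <= L * (g * E z).
      apply: (@le_trans _ _ (L2 * (g * E z))).
        rewrite /L2 [leRHS]mulrDl mul1r lerD2l.
        have gE : 0 < g * E (B + 1) by rewrite mulr_gt0.
        apply: (@le_trans _ _ (B / (g * E (B + 1)) * (g * E (B + 1)))).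
          by rewrite divfK// gt_eqF.
        apply: ler_wpM2l; first by rewrite divr_ge0// ltW.
        by rewrite ler_pM2l// Emono// ltW.
      by rewrite ler_pM2r ?mulr_gt0// lerDr ltW.
    have : B * p <= B by rewrite -[leRHS]mulr1 ler_wpM2l.
    lra.
  have ps : p <= z `^ (- s - m%:R) by rewrite ler_powR// /k; lra.
  apply: (@le_trans _ _ ((1 + C2 + B + L * D2 + L * g * D2) * p)); last first.
    by rewrite ler_wpM2l// !addr_ge0// ?mulr_ge0 ?ltW// ?mulr_gt0.
  have H1 : L * (g * E z) <= L * (g * (D2 * p)) by rewrite !ler_pM2l// ED.
  have H2 : 0 <= C2 * p + L * D2 * p by rewrite addr_ge0// !mulr_ge0// ltW.
  lra.
Qed.

End operator.
End profile.

(** * Iterated integrals *)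

Section iterated_integrals.
Set Implicit Arguments.
Unset Strict Implicit.
Context {R : realType}.
Local Open Scope ereal_scope.

Lemma ge0_integral_mono d (T : measurableType d) (mu : {measure set T -> \bar R})
    (A : set T) (f g : T -> \bar R) :
  (forall x, A x -> 0 <= f x) -> (forall x, A x -> f x <= g x) ->
  \int[mu]_(x in A) f x <= \int[mu]_(x in A) g x.
Proof.
move=> f0 fg.
have g0 x : A x -> 0 <= g x by move=> Ax; exact: le_trans (f0 _ Ax) (fg _ Ax).
rewrite !ge0_integralE//; apply: le_ereal_sup => _ [h /= hf <-]; exists h => //= x.
apply: le_trans (hf x) _; rewrite !patchE; case: ifPn => // xA.
by apply: fg; rewrite inE in xA.
Qed.

Lemma ge0_integral_ge_cst (A B : set R) (f : R -> \bar R) (c : R) :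
  measurable B -> B `<=` A -> (0 <= c)%R -> (forall x, A x -> 0 <= f x) ->
  (forall x, B x -> c%:E <= f x) ->
  c%:E * lebesgue_measure B <= \int[@lebesgue_measure R]_(x in A) f x.
Proof.
move=> mB BA c0 f0 cf.
have -> : c%:E * lebesgue_measure B = \int[@lebesgue_measure R]_(x in B) (cst c%:E) x.
  by rewrite integral_cst.
rewrite integral_mkcond [leRHS]integral_mkcond.
apply: ge0_integral_mono => x _; rewrite !patchE.
  by case: ifPn => // _; rewrite lee_fin.
case: ifPn => xB.
  by rewrite ifT; [apply: cf; rewrite inE in xB|rewrite !inE in xB *; exact: BA].
by case: ifPn => // xA; apply: f0; rewrite inE in xA.
Qed.

Lemma iint_ge0 m (f : 'rV[R]_m -> \bar R) : (forall y, 0 <= f y) -> 0 <= iint f.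
Proof.
elim: m f => [|m IH] f f0 /=; first exact: f0.
by apply: integral_ge0 => a _; apply: IH => y.
Qed.

Lemma row_mx_head m (a : R) (y : 'rV[R]_m) :
  (row_mx (const_mx a : 'rV[R]_1) y : 'rV[R]_(1 + m)) ord0 ord0 = a.
Proof.
rewrite (_ : ord0 = lshift m (ord0 : 'I_1)); last exact: val_inj.
by rewrite row_mxEl mxE.
Qed.

Lemma row_mx_tail m (a : R) (y : 'rV[R]_m) (k : 'I_m) :
  (row_mx (const_mx a : 'rV[R]_1) y : 'rV[R]_(1 + m)) ord0 (lift ord0 k) = y ord0 k.
Proof.
by rewrite (_ : lift ord0 k = rshift 1 k); [rewrite row_mxEr|exact: val_inj].
Qed.

Lemma iint_ge_box m (f : 'rV[R]_m -> \bar R) (x : 'rV[R]_m) (d c : R) :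
  (0 <= d)%R -> (0 <= c)%R -> (forall y, 0 <= f y) ->
  (forall y : 'rV[R]_m, (forall k, `|y ord0 k - x ord0 k| <= d)%R -> c%:E <= f y) ->
  (c * (2 * d) ^+ m)%:E <= iint f.
Proof.
move=> d0; elim: m f x c => [|m IH] f x c c0 f0 cf /=.
  by rewrite expr0 mulr1; apply: cf => -[].
pose x' : 'rV[R]_m := \row_k x ord0 (lift ord0 k).
rewrite exprS mulrCA mulrC EFinM.
have -> : (2 * d)%:E = lebesgue_measure `[(x ord0 ord0 - d)%R, (x ord0 ord0 + d)%R]%classic.
  rewrite lebesgue_measure_itv /= lte_fin; case: ltP => H.
    by rewrite -EFinB; congr (_%:E); ring.
  by congr (_%:E); lra.
apply: ge0_integral_ge_cst => //.
- by rewrite mulr_ge0// exprn_ge0// mulr_ge0.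
- by move=> a _; exact: iint_ge0.
- move=> a /=; rewrite in_itv /= => Ha; apply: (IH _ x') => // y Hy.
  apply: cf => k; have [->|[k' ->]] : k = ord0 \/ exists k', k = lift ord0 k'.
    by case: (unliftP ord0 k) => [k' ->|->]; [right; exists k'|left].
  + by rewrite row_mx_head ler_norml; move: Ha; lra.
  + by rewrite row_mx_tail; have := Hy k'; rewrite mxE.
Qed.

Lemma iint_le_prod m (N : nat) (f : 'rV[R]_m -> \bar R) (c : 'I_N -> R)
    (g : 'I_N -> R -> R) (K : 'I_N -> R) :
  (forall i, 0 <= c i)%R -> (forall i a, 0 <= g i a)%R ->
  (forall i, measurable_fun setT (g i)) ->
  (forall i, 0 <= K i)%R ->
  (forall i, \int[@lebesgue_measure R]_a (g i a)%:E <= (K i)%:E) ->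
  (forall y, 0 <= f y) ->
  (forall y : 'rV[R]_m, f y <= (\sum_(i < N) c i * \prod_(k < m) g i (y ord0 k))%:E) ->
  iint f <= (\sum_(i < N) c i * K i ^+ m)%:E.
Proof.
move=> + g0 mg K0 HK; elim: m f c => [|m IH] f c c0 f0 Hf /=.
  apply: le_trans (Hf 0%R) _; rewrite lee_fin; apply: ler_sum => i _.
  by rewrite big_ord0 expr0.
apply: (@le_trans _ _ (\int[@lebesgue_measure R]_a
    (\sum_(i < N) ((c i * K i ^+ m)%:E * (g i a)%:E)))).
  apply: ge0_integral_mono => a _; first by apply: iint_ge0 => y.
  have -> : \sum_(i < N) ((c i * K i ^+ m)%:E * (g i a)%:E) =
     (\sum_(i < N) (c i * g i a) * K i ^+ m)%:E.
    by rewrite sumEFin; congr (_%:E); apply: eq_bigr => i _; rewrite mulrAC.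
  apply: IH => [i|y|y]; [by rewrite mulr_ge0|exact: f0|].
  apply: le_trans (Hf _) _; rewrite lee_fin; apply: ler_sum => i _.
  rewrite big_ord_recl row_mx_head mulrA ler_wpM2l ?mulr_ge0//.
  by rewrite le_eqVlt; apply/orP; left; apply/eqP; apply: eq_bigr => k _; rewrite row_mx_tail.
rewrite ge0_integral_sum//; first last.
- by move=> i a _; rewrite -EFinM lee_fin !mulr_ge0// exprn_ge0.
- by move=> i; apply: measurable_funeM; apply: measurableT_comp => //; exact: mg.
rewrite -sumEFin; apply: lee_sum => i _.
rewrite ge0_integralZl//; first last.
- by rewrite lee_fin mulr_ge0// exprn_ge0.
- by move=> a _; rewrite lee_fin.
- by apply: measurableT_comp => //; exact: mg.
rewrite exprSr mulrA [leRHS]EFinM; apply: lee_pmul => //.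
- by rewrite lee_fin mulr_ge0// exprn_ge0.
- by apply: integral_ge0 => a _; rewrite lee_fin.
Qed.

End iterated_integrals.

(** * One-dimensional integrals of powers *)

Section power_integrals.
Set Implicit Arguments.
Unset Strict Implicit.
Context {R : realType}.

Lemma is_derive_powR_shift (s e t : R) : s < t ->
  is_derive t 1 (fun t : R => (t - s) `^ e) (e * (t - s) `^ (e - 1)).
Proof.
move=> st; have t0 : 0 < t - s by rewrite subr_gt0.
have Ht0 : is_derive t 1 (fun t : R => t - s) 1.
  by apply: is_derive_eq; rewrite /GRing.scale /=; ring.
have := is_derive_comp_dir Ht0 (is_derive1_powR e t0).
by rewrite mulr1.
Qed.

Lemma continuous_powR_shift (s e t : R) : s < t ->
  {for t, continuous (fun t : R => (t - s) `^ e)}.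
Proof.
move=> st; have [H _] := is_derive_powR_shift e st.
exact: differentiable_continuous ((derivable1_diffP _ t).1 H).
Qed.

Lemma integral_powR_shift (s a b g : R) : s < a -> a < b -> g < 1 ->
  (\int[@lebesgue_measure R]_(t in `[a, b]) ((t - s) `^ (- g))%:E
    <= ((b - s) `^ (1 - g) / (1 - g))%:E)%E.
Proof.
move=> sa ab g1; have g0 : 1 - g != 0 by rewrite gt_eqF// subr_gt0.
have HF t : s < t -> is_derive t 1 (fun t : R => (t - s) `^ (1 - g) / (1 - g)) ((t - s) `^ (- g)).
  move=> st; have H := is_derive_powR_shift (1 - g) st.
  have H2 := is_deriveZ (1 - g)^-1 H.
  rewrite (_ : (fun t : R => _) = (1 - g)^-1 *: (fun t : R => (t - s) `^ (1 - g))).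
    apply: (is_derive_eq H2); rewrite /GRing.scale /= mulrA mulVf// mul1r.
    by congr (_ `^ _); ring.
  by apply/funext => y; rewrite mulrC.
have cF t : s < t -> {for t, continuous (fun t : R => (t - s) `^ (1 - g) / (1 - g))}.
  move=> st; have [H _] := HF t st.
  exact: differentiable_continuous ((derivable1_diffP _ t).1 H).
rewrite (@continuous_FTC2 _ _ (fun t : R => (t - s) `^ (1 - g) / (1 - g)))//.
- rewrite -EFinB lee_fin lerBlDr lerDl divr_ge0 ?powR_ge0// subr_ge0 ltW//.
- apply: continuous_in_subspaceT => t; rewrite inE /= in_itv /= => /andP[at_ _].
  by apply: continuous_powR_shift; exact: lt_le_trans at_.
- split.
  + move=> t; rewrite in_itv /= => /andP[at_ _].
    by have [] := HF t (lt_trans sa at_).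
  + by apply: cvg_at_right_filter; exact: cF.
  + by apply: cvg_at_left_filter; apply: cF; exact: lt_trans ab.
- move=> t; rewrite in_itv /= => /andP[at_ _].
  by have [_] := HF t (lt_trans sa at_); rewrite derive1E.
Qed.

Lemma cvgy_powRN (e : R) : 0 < e -> x `^ (- e) @[x --> +oo] --> (0 : R).
Proof.
move=> e0; apply/cvgr0Pnorm_lt => d d0.
near=> x; have x0 : 0 < x by near: x; exact: nbhs_pinfty_gt.
rewrite ger0_norm ?powR_ge0// powRN -[d]invrK ltf_pV2 ?posrE ?invr_gt0 ?powR_gt0//.
have dE : d^-1 = (d^-1 `^ (e^-1)) `^ e.
  by rewrite -powRrM mulVf ?gt_eqF// powRr1// invr_ge0 ltW.
rewrite dE.
have H : d^-1 `^ (e^-1) < x by near: x; apply: nbhs_pinfty_gt; rewrite num_real.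
by apply: gt0_ltr_powR => //; rewrite ?nnegrE ?powR_ge0 ?(ltW x0).
Unshelve. all: by end_near. Qed.

(** By evenness it suffices to integrate over [a >= 0], where [a^2 + tau >= (a + sqrt tau)^2 / 2];
    the resulting shifted power has the explicit primitive [F], whose value at zero gives the power
    of [tau]. *)
Lemma integral_japanese_bracket (m : R) : 2^-1 < m ->
  exists2 C : R, 0 < C & forall tau, 0 < tau ->
  (\int[@lebesgue_measure R]_a ((a ^+ 2 + tau) `^ (- m))%:E
     <= (C * tau `^ (2^-1 - m))%:E)%E.
Proof.
move=> m2; have m0 : 0 < 2 * m - 1 by lra.
exists (2 * 2 `^ m / (2 * m - 1)) => [|tau tau0].
  by rewrite !mulr_gt0 ?powR_gt0 ?invr_gt0.
pose sg := tau `^ 2^-1; have sg0 : 0 < sg by rewrite powR_gt0.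
have sg2 : sg ^+ 2 = tau.
  by rewrite -powR_mulrn ?ltW// -powRrM mulVf ?powRr1// ltW.
have base (a : R) : 0 < a ^+ 2 + tau by rewrite ltr_wpDl// sqr_ge0.
have cf : continuous (fun a : R => (a ^+ 2 + tau) `^ (- m)).
  move=> a; have H1 : is_derive a 1 (fun a : R => a ^+ 2 + tau) (2 * a).
    by apply: is_derive_eq; rewrite /GRing.scale /=; ring.
  have [H _] := is_derive_comp_dir H1 (is_derive1_powR (- m) (base a)).
  exact: differentiable_continuous ((derivable1_diffP _ a).1 H).
rewrite ge0_symfun_integralT//; first last.
- by move=> a /=; rewrite sqrrN.
- by move=> a; exact: powR_ge0.
have -> : 2 * 2 `^ m / (2 * m - 1) * tau `^ (2^-1 - m) =
    2 * (2 `^ m * (sg `^ (1 - 2 * m) / (2 * m - 1))).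
  rewrite /sg -powRrM (_ : 2^-1 * (1 - 2 * m) = 2^-1 - m); last by field.
  by field; rewrite gt_eqF.
rewrite EFinM; apply: lee_pmul => //.
  by apply: integral_ge0 => a _; rewrite lee_fin powR_ge0.
have s0 : - sg < 0 by rewrite oppr_lt0.
pose F (a : R) := - (2 `^ m / (2 * m - 1)) * (a - (- sg)) `^ (1 - 2 * m).
have HF (a : R) : - sg < a -> is_derive a 1 F (2 `^ m * (a - (- sg)) `^ (- (2 * m))).
  move=> sa; have H := is_derive_powR_shift (1 - 2 * m) sa.
  have H2 := is_deriveZ (- (2 `^ m / (2 * m - 1))) H.
  apply: (is_derive_eq H2); rewrite /GRing.scale /=.
  rewrite (_ : 1 - 2 * m - 1 = - (2 * m)); last by ring.
  by field; rewrite gt_eqF.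
apply: (@le_trans _ _ (\int[@lebesgue_measure R]_(x in `[0%R, +oo[)
    (2 `^ m * (x - (- sg)) `^ (- (2 * m)))%:E)%E).
  rewrite (_ : [set x : R | 0 <= x] = `[0%R, +oo[%classic); last first.
    by apply/seteqP; split => a /=; rewrite in_itv /= andbT.
  apply: ge0_integral_mono => a; first by rewrite lee_fin powR_ge0.
  rewrite /= in_itv /= andbT opprK lee_fin => a0.
  have as0 : 0 < a + sg by rewrite ltr_wpDl.
  have -> : 2 `^ m * (a + sg) `^ (- (2 * m)) = ((a + sg) ^+ 2 / 2) `^ (- m).
    rewrite powRM ?sqr_ge0// -powR_inv1// -(powRrM 2) mulN1r opprK mulrC; congr (_ * _).
    by rewrite -powR_mulrn ?ltW// -powRrM; congr (_ `^ _); ring.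
  rewrite !powRN lef_pV2 ?posrE ?powR_gt0// ?divr_gt0 ?exprn_gt0//.
  have h1 : (a + sg) ^+ 2 / 2 <= a ^+ 2 + tau.
    by rewrite -sg2; have := sqr_ge0 (a - sg); lra.
  apply: ge0_ler_powR h1; rewrite ?nnegrE; first by lra.
    by rewrite divr_ge0// sqr_ge0.
  exact: ltW.
rewrite (@ge0_continuous_FTC2y _ _ F 0 0).
- rewrite -EFinB lee_fin sub0r /F sub0r opprK mulNr opprK.
  by rewrite -mulrA (mulrC _^-1).
- by move=> a _; rewrite mulr_ge0 ?powR_ge0.
- apply: continuous_in_subspaceT => a; rewrite inE /= in_itv /= andbT => a0.
  apply: cvgM; first exact: cvg_cst.
  by apply: continuous_powR_shift; exact: lt_le_trans a0.
- rewrite -[X in _ --> X](mulr0 (- (2 `^ m / (2 * m - 1)))).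
  apply: cvgM; first exact: cvg_cst.
  have -> : 1 - 2 * m = - (2 * m - 1) by ring.
  apply: (@cvg_comp _ _ _ (fun x : R => x - - sg) (fun x => x `^ (- (2 * m - 1))) _ +oo).
    apply/cvgryPge => A; near=> x; rewrite opprK -lerBlDr.
    by near: x; apply: nbhs_pinfty_ge; rewrite num_real.
  exact: cvgy_powRN.
- by move=> a a0; have [] := HF a (lt_trans s0 a0).
- apply: cvg_at_right_filter; have [H _] := HF 0 s0.
  exact: differentiable_continuous ((derivable1_diffP _ 0).1 H).
- move=> a; rewrite in_itv /= andbT => a0.
  by have [_] := HF a (lt_trans s0 a0); rewrite derive1E.
Unshelve. all: by end_near. Qed.

End power_integrals.

(** * Lower bound for the nonlocal term *)

Section nonlocal_term.
Set Implicit Arguments.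
Unset Strict Implicit.
Context {R : realType} {n : nat}.

Lemma powR_anti (a b e : R) : 0 < a -> a <= b -> 0 <= e -> b `^ (- e) <= a `^ (- e).
Proof.
move=> a0 ab e0; have b0 : 0 < b by apply: lt_le_trans ab.
by rewrite !powRN lef_pV2 ?posrE ?powR_gt0// ge0_ler_powR// nnegrE ltW.
Qed.

Lemma powR_mono (a b e : R) : 0 <= a -> a <= b -> 0 <= e -> a `^ e <= b `^ e.
Proof.
by move=> a0 ab e0; apply: ge0_ler_powR; rewrite ?nnegrE ?(le_trans a0 ab).
Qed.

(** Only the cube of half-side [sqrt r] around [x] and the times [[t - 2r, t - r]] are kept; there
    the kernel is at least of order [r^{-n/2}]. The exponent adds [-alpha/2] from the kernel, [n/2]
    from the cube and [1] from the time interval. *)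
Lemma nonlocal_ge (alpha lambda : R) : (0 < n)%N -> 0 < alpha -> 0 < lambda ->
  exists2 c : R, 0 < c &
  forall (u : 'rV[R]_n -> R -> R) (x : 'rV[R]_n) (t r L : R),
    0 < r -> 0 < t - 2 * r -> t < 1 -> 0 <= L ->
    (forall (y : 'rV[R]_n) (s : R), (forall k, `|y ord0 k - x ord0 k| <= r `^ 2^-1) ->
       t - 2 * r <= s <= t - r -> L <= u y s) ->
    ((c * r `^ ((n%:R + 2 - alpha) / 2) * L `^ lambda)%:E <=
      STint (fun y s => (Phi (x - y) (t - s) `^ (alpha / n%:R) * u y s `^ lambda)%:E))%E.
Proof.
move=> n0 al0 la0.
have nR : (0 : R) < n%:R by rewrite ltr0n.
(* [8 pi r] bounds [4 pi (t - s)] because [t - s <= 2 r]; the factor [exp(-n/4)] below comes from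
   [|x - y|^2 <= n r <= n (t - s)]. *)
pose P := (8 * pi : R); have P0 : 0 < P by rewrite mulr_gt0// pi_gt0.
pose Q := (P `^ (- (n%:R / 2)) * expR (- (n%:R / 4)) : R) `^ (alpha / n%:R).
have Q0 : 0 < Q by rewrite powR_gt0// mulr_gt0 ?powR_gt0 ?expR_gt0.
exists (2 ^+ n * Q) => [|u x t r L r0 tr t1 L0 HL]; first by rewrite mulr_gt0// exprn_gt0.
pose q := r `^ 2^-1; have q0 : 0 < q by rewrite powR_gt0.
have q2 : q ^+ 2 = r by rewrite -powR_mulrn ?ltW// -powRrM mulVf ?powRr1// ltW.
pose K := ((P * r) `^ (- (n%:R / 2)) * expR (- (n%:R / 4))) `^ (alpha / n%:R) * L `^ lambda.
have K0 : 0 <= K by rewrite mulr_ge0 ?powR_ge0.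
have -> : (2 ^+ n * Q * r `^ ((n%:R + 2 - alpha) / 2) * L `^ lambda)%:E =
   ((K * (2 * q) ^+ n)%:E * lebesgue_measure `[(t - 2 * r)%R, (t - r)%R]%classic)%E.
  rewrite lebesgue_measure_itv /= lte_fin ifT; last by lra.
  rewrite -EFinB -EFinM; congr (_%:E).
  rewrite (_ : t - r - (t - 2 * r) = r); last by ring.
  rewrite /K /Q exprMn (powRM _ (ltW P0) (ltW r0)) .
  rewrite (mulrAC (P `^ _)) (powRM _ _ (powR_ge0 _ _)); last first.
    by rewrite mulr_ge0 ?powR_ge0 ?expR_ge0.
  have -> : (r `^ (- (n%:R / 2))) `^ (alpha / n%:R) = r `^ (- (alpha / 2)).
    by rewrite -powRrM; congr (_ `^ _); field; rewrite gt_eqF.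
  have -> : q ^+ n = r `^ (n%:R / 2).
    by rewrite -powR_mulrn ?ltW// -powRrM; congr (_ `^ _); rewrite mulrC.
  have -> : r `^ ((n%:R + 2 - alpha) / 2) = r `^ (- (alpha / 2)) * r `^ (n%:R / 2) * r `^ 1.
    rewrite -!powRD;
      try by rewrite (gt_eqF r0) implybT.
    by congr (_ `^ _); field.
  by rewrite (powRr1 (ltW r0)); ring.
apply: ge0_integral_ge_cst => //.
- by move=> s /=; rewrite !in_itv /= => /andP[s1 s2]; apply/andP; split; lra.
- by rewrite mulr_ge0// exprn_ge0// mulr_ge0// ltW.
- move=> s _; apply: iint_ge0 => y; by rewrite lee_fin mulr_ge0 ?powR_ge0.
move=> s /=; rewrite in_itv /= => Hs.
apply: (iint_ge_box (x := x)) => //; first exact: ltW.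
  by move=> y; rewrite lee_fin mulr_ge0 ?powR_ge0.
move=> y Hy; rewrite lee_fin; apply: ler_pM; rewrite ?powR_ge0//; last first.
  by apply: powR_mono; rewrite ?(ltW la0)//; exact: HL.
have ts0 : 0 < t - s by lra.
apply: powR_mono.
- by rewrite mulr_ge0 ?powR_ge0 ?expR_ge0.
- rewrite /Phi ts0; apply: ler_pM; rewrite ?powR_ge0 ?expR_ge0//.
    apply: powR_anti; rewrite ?divr_ge0// ?mulr_gt0 ?pi_gt0//.
    rewrite /P (mulrAC 4) (mulrAC 8) ler_pM2r ?pi_gt0//; lra.
  rewrite ler_expR mulNr lerN2 ler_pdivrMr ?mulr_gt0//.
  have : sqnorm (x - y) <= n%:R * r.
    rewrite -[n in n%:R]card_ord -sum1_card natr_sum mulr_suml.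
    apply: ler_sum => k _; rewrite mul1r !mxE -q2 -real_normK ?num_real//.
    by rewrite lerXn2r ?nnegrE ?(ltW q0)// distrC.
  have : n%:R * r <= n%:R * (t - s) by rewrite ler_pM2l//; lra.
  lra.
- by rewrite divr_ge0// ltW.
Qed.

End nonlocal_term.

(** * Bursts *)

Section bursts.
Set Implicit Arguments.
Unset Strict Implicit.
Context {R : realType} {n : nat}.
Implicit Types (x y : 'rV[R]_n) (t T : R).

Definition selfsim (s0 s : R) (G : nat -> R -> R) x t : R :=
  (t - s0) `^ (- s) * G 0%N (1 + sqnorm x / (t - s0)).

Lemma sqnorm_Ck_on (O : set R) k : Ck_on O k (fun x _ => sqnorm x).
Proof.
pose F (i : nat) x t := if insub i is Some j then x ord0 (j : 'I_n) ^+ 2 else 0.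
have : Ck_on O k (fun x t => \sum_(i < n) F i x t).
  apply: Ck_on_sum => i iN; rewrite /F insubT; have := Ck_on_coord O k (Ordinal iN).
  by move=> S; exact: (Ck_onM S S).
congr (Ck_on O k _); apply/funext => x; apply/funext => t; rewrite /sqnorm.
by apply: eq_bigr => i _; rewrite /F valK.
Qed.

Lemma zarg_ge1 (s0 : R) x t : s0 < t -> 1 <= 1 + sqnorm x / (t - s0).
Proof. by move=> st; rewrite lerDl divr_ge0 ?sqnorm_ge0// subr_ge0 ltW. Qed.

Lemma selfsim_Ck_on (s0 s : R) G (O : set R) k : open O -> tower [set z : R | 0 < z] G ->
  (forall t, O t -> s0 < t) -> Ck_on O k (selfsim s0 s G).
Proof.
move=> oO TG Os; have S1 : Ck_on O k (fun (_ : 'rV[R]_n) t => t - s0).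
  by apply: Ck_onD; [exact: Ck_on_t|exact: Ck_on_cst].
have P1 (x : 'rV[R]_n) t : O t -> [set z : R | 0 < z] (t - s0).
  by move=> /Os /=; rewrite subr_gt0.
have powS e : Ck_on O k (fun (_ : 'rV[R]_n) t => (t - s0) `^ e).
  have := Ck_on_comp (powR_tower e) S1 P1 0%N; congr (Ck_on O k _).
  by apply/funext => x; apply/funext => t; rewrite big_ord0 mul1r subr0.
apply: Ck_onM; first exact: powS.
apply: (Ck_on_comp TG) => [|x t Ot].
  apply: Ck_onD; first exact: Ck_on_cst.
  apply: Ck_onM; first exact: sqnorm_Ck_on.
  apply: (Ck_on_eq oO (powS (-1))) => _ t /Os st.
  by rewrite powR_inv1// subr_ge0 ltW.
by apply: lt_le_trans (zarg_ge1 _ (Os _ Ot)).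
Qed.

Lemma is_heat_selfsim (s0 s : R) G x t : tower [set z : R | 0 < z] G -> s0 < t ->
  is_heat (selfsim s0 s G) x t
    ((t - s0) `^ (- s - 1) * ssheat n s G (1 + sqnorm x / (t - s0))).
Proof.
move=> TG st.
have := is_heat_selfsimilar s x (TG 0%N) (TG 1%N) st.
by rewrite /ssheat mulNr -mulrN.
Qed.

(** The heat kernel born at time [s0], without the factor [(4 pi)^{-n/2}]. It has this meaning for
    [t > s0] only; at earlier times [piece] multiplies it by a vanishing cutoff. *)
Definition kern (s0 : R) : 'rV[R]_n -> R -> R := selfsim s0 (n%:R / 2) gauss_tower.

Lemma kernE (s0 : R) x t : s0 < t ->
  kern s0 x t = (t - s0) `^ (- (n%:R / 2)) * expR (- (sqnorm x / (4 * (t - s0)))).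
Proof.
move=> st; rewrite /kern /selfsim /gauss_tower expr0 mul1r; congr (_ * expR _).
by field; rewrite subr_eq0 gt_eqF.
Qed.

Lemma kern_ge0 (s0 : R) x t : 0 <= kern s0 x t.
Proof. by rewrite mulr_ge0 ?powR_ge0// /gauss_tower expr0 mul1r expR_ge0. Qed.

Lemma is_heat_kern (s0 : R) x t : s0 < t -> is_heat (kern s0) x t 0.
Proof.
move=> st; have := @is_heat_selfsim s0 (n%:R / 2) _ x t (@gauss_towerP R _) st.
by rewrite ssheat_gauss subrr mul0r mulr0.
Qed.

Definition scale T (i : nat) : R := T / 4 ^+ i.+2.

Definition onset T i : R := T - 3 * scale T i.

Lemma scale_gt0 T i : 0 < T -> 0 < scale T i.
Proof. by move=> T0; rewrite divr_gt0// exprn_gt0. Qed.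

Lemma scaleS T i : scale T i.+1 = scale T i / 4.
Proof. by rewrite /scale exprS; field; rewrite expf_neq0. Qed.

Lemma scale_le T i j : 0 < T -> (i <= j)%N -> scale T j <= scale T i.
Proof.
move=> T0; elim: j => [|j IH]; first by rewrite leqn0 => /eqP ->.
rewrite leq_eqVlt => /orP[/eqP ->//|ij]; rewrite scaleS.
by apply: le_trans (IH ij); have := scale_gt0 j T0; lra.
Qed.

Lemma scale0 T : scale T 0 = T / 16.
Proof. by rewrite /scale; congr (_ / _); ring. Qed.

Lemma scale_le16 T i : 0 < T -> scale T i <= T / 16.
Proof. by move=> T0; rewrite -scale0; exact: scale_le. Qed.

Section burst.
Variable b : R.

Definition piece T i x t : R :=
  chi ((t - onset T i) / scale T i) * (scale T i `^ b * kern (onset T i) x t).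

(** The kernel solves the heat equation, so applying the heat operator to [piece] leaves only the
    time derivative of the switch. *)
Definition source T i x t : R :=
  dchi ((t - onset T i) / scale T i) / scale T i *
    (scale T i `^ b * kern (onset T i) x t).

Lemma piece_ge0 T i x t : 0 <= piece T i x t.
Proof. exact: mulr_ge0 (chi_ge0 _) (mulr_ge0 (powR_ge0 _ _) (kern_ge0 _ _ _)). Qed.

Lemma source_ge0 T i x t : 0 < T -> 0 <= source T i x t.
Proof.
move=> T0; apply: mulr_ge0 _ (mulr_ge0 (powR_ge0 _ _) (kern_ge0 _ _ _)).
by rewrite divr_ge0 ?dchi_ge0// ltW// scale_gt0.
Qed.

Lemma piece_eq0 T i x t : 0 < T -> t <= onset T i + scale T i -> piece T i x t = 0.
Proof.
move=> T0 tT; rewrite /piece chi_eq0 ?mul0r//.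
by rewrite ler_pdivrMr ?scale_gt0//; lra.
Qed.

Lemma source_eq0 T i x t : 0 < T ->
  (t <= onset T i + scale T i) || (onset T i + 2 * scale T i <= t) ->
  source T i x t = 0.
Proof.
move=> T0 H; rewrite /source dchi_eq0 ?mul0r//.
rewrite ler_pdivrMr ?scale_gt0// ler_pdivlMr ?scale_gt0//.
by case/orP: H => H; apply/orP; [left|right]; lra.
Qed.

Let openl (a : R) : open [set t : R | t < a].
Proof. exact: open_lt. Qed.

Let openr (a : R) : open [set t : R | a < t].
Proof. exact: open_gt. Qed.

(** The kernel is singular at its birth, but the piece vanishes up to [onset + scale]; zero and the
    formula are local descriptions on two overlapping open time sets. *)
Lemma piece_Ck_on T i k : 0 < T -> Ck_on setT k (piece T i).
Proof.
move=> T0; have r0 := scale_gt0 i T0; apply: Ck_on_local => t _.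
case: (ltP t (onset T i + scale T i)) => H.
  exists [set t : R | t < onset T i + scale T i], (fun _ _ => 0); split => //.
    exact: Ck_on_cst.
  by move=> y u /= Hu; rewrite piece_eq0// ltW.
exists [set t : R | onset T i < t], (piece T i); split => //=; first by lra.
apply: Ck_onM.
  apply: Ck_on_chi; apply: Ck_onM; last exact: Ck_on_cst.
  by apply: Ck_onD; [exact: Ck_on_t|exact: Ck_on_cst].
apply: Ck_onM; first exact: Ck_on_cst.
exact: selfsim_Ck_on (@gauss_towerP R _) _.
Qed.

Lemma is_derive_chi_affine (s0 r t : R) :
  is_derive t 1 (fun t : R => chi ((t - s0) / r)) (dchi ((t - s0) / r) / r).
Proof.
have H : is_derive t 1 (fun t : R => (t - s0) / r) r^-1.
  by apply: is_derive_eq; rewrite /GRing.scale /=; ring.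
exact: is_derive_comp_dir H (is_derive_chi _).
Qed.

Lemma is_heat_piece T i x t : 0 < T -> is_heat (piece T i) x t (source T i x t).
Proof.
move=> T0; have r0 := scale_gt0 i T0.
case: (ltP t (onset T i + scale T i)) => H.
  have -> : source T i x t = 0 by apply: source_eq0 => //; rewrite (ltW H).
  apply: (@is_heat_local _ _ _ (fun _ _ => 0) x t 0 _ (@openl (onset T i + scale T i)) H);
    last exact: is_heat_cst.
  by move=> y u /= Hu; rewrite piece_eq0// ltW.
have st : onset T i < t by lra.
have H1 := is_heatM_time (is_derive_cst (scale T i `^ b) t 1) (is_heat_kern x st).
have H2 := is_heatM_time (is_derive_chi_affine (onset T i) (scale T i) t) H1.
by move: H2; rewrite /= mulr0 mul0r addr0 mulr0 add0r.
Qed.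

(** The switch-off factor is one up to [2 T] and zero from [4 T] on, so the burst lives in
    [[T/2, 4 T]]; with peaks a factor [16] apart, distinct bursts never overlap. *)
Definition burst T (N : nat) x t : R :=
  (1 - chi (t / (2 * T))) * \sum_(i < N) piece T i x t.

Lemma burst_ge0 T N x t : 0 <= burst T N x t.
Proof.
rewrite mulr_ge0 ?subr_ge0 ?chi_le1//; apply: sumr_ge0 => i _; exact: piece_ge0.
Qed.

Lemma burst_eq0 T N x t : 0 < T -> (t <= T / 2) || (4 * T <= t) -> burst T N x t = 0.
Proof.
move=> T0 /orP[tT|tT]; rewrite /burst.
  rewrite big1 ?mulr0// => i _; rewrite piece_eq0//.
  by rewrite /onset; have := scale_le16 i T0; lra.
by rewrite chi_eq1 ?subrr ?mul0r// ler_pdivlMr ?mulr_gt0//; lra.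
Qed.

Lemma burst_Ck_on T N k : 0 < T -> Ck_on setT k (burst T N).
Proof.
move=> T0; apply: Ck_onM; last by apply: Ck_on_sum => i _; exact: piece_Ck_on.
apply: Ck_onD; first exact: Ck_on_cst.
rewrite (_ : (fun _ _ => _) = (fun (_ : 'rV[R]_n) t => -1 * chi (t / (2 * T)))); last first.
  by apply/funext => x; apply/funext => t; rewrite mulN1r.
apply: Ck_onM; first exact: Ck_on_cst.
by apply: Ck_on_chi; apply: Ck_onM; [exact: Ck_on_t|exact: Ck_on_cst].
Qed.

Lemma is_heat_burst T N x t : 0 < T -> is_heat (burst T N) x t
  ((1 - chi (t / (2 * T))) * (\sum_(i < N) source T i x t) -
   dchi (t / (2 * T)) / (2 * T) * \sum_(i < N) piece T i x t).
Proof.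
move=> T0.
have H1 : is_derive t 1 (fun t : R => 1 - chi (t / (2 * T))) (- (dchi (t / (2 * T)) / (2 * T))).
  have H := is_derive_chi_affine 0 (2 * T) t.
  rewrite (_ : (fun t : R => 1 - chi (t / (2 * T))) =
    (fun t : R => 1 - chi ((t - 0) / (2 * T)))); last first.
    by apply/funext => u; rewrite subr0.
  have H3 := is_deriveB (is_derive_cst (1 : R) t 1) H.
  by apply: (is_derive_eq H3); rewrite subr0 sub0r.
have H2 : is_heat (fun x t => \sum_(i < N) piece T i x t) x t (\sum_(i < N) source T i x t).
  by apply: (is_heat_sum (F := piece T) (h := fun i => source T i x t)) => i _; exact: is_heat_piece.
have := is_heatM_time H1 H2.
by rewrite mulNr.
Qed.

End burst.
End bursts.

(** * Size of the kernels and of their sources *)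

Section estimates.
Set Implicit Arguments.
Unset Strict Implicit.
Context {R : realType} {n : nat}.
Implicit Types (x y : 'rV[R]_n) (t T : R).

Lemma powR_addp (r a b : R) : 0 < r -> r `^ (a + b) = r `^ a * r `^ b.
Proof. by move=> r0; rewrite powRD// (gt_eqF r0) implybT. Qed.

Lemma powRB1 (r a : R) : 0 < r -> r `^ (a - 1) = r `^ a / r.
Proof. by move=> r0; rewrite powR_addp// powR_inv1// ltW. Qed.

Lemma geometric_sum_le (k : R) N : 0 < k < 1 -> \sum_(i < N) k ^+ i <= (1 - k)^-1.
Proof.
move=> /andP[k0 k1]; have h : 0 < 1 - k by rewrite subr_gt0.
rewrite -[leRHS]div1r ler_pdivlMr// mulrC -[1 - k]opprB mulNr -subrX1 opprB.
by rewrite gerBl exprn_ge0// ltW.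
Qed.

Variable s : R.
Hypotheses (s_gt0 : 0 < s) (s_lt : s < n%:R / 2).
Let b : R := n%:R / 2 - s.

Let b_gt0 : 0 < b. Proof. by rewrite subr_gt0. Qed.

Lemma piece_ge T i x t : 0 < T -> onset T i + 2 * scale T i <= t <= T ->
  3 `^ (- (n%:R / 2)) * (scale T i `^ (- s) * expR (- (sqnorm x / (8 * scale T i))))
    <= piece b T i x t.
Proof.
move=> T0 /andP[t1 t2]; have r0 := scale_gt0 i T0.
have st : onset T i < t by lra.
have tau0 : 0 < t - onset T i by rewrite subr_gt0.
have tau3 : t - onset T i <= 3 * scale T i by rewrite /onset; lra.
rewrite /piece chi_eq1 ?mul1r; last by rewrite ler_pdivlMr//; lra.
rewrite kernE// (_ : - s = b + - (n%:R / 2)); last by rewrite /b; ring.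
rewrite powR_addp// [leLHS](_ : _ = scale T i `^ b *
   ((3 * scale T i) `^ (- (n%:R / 2)) * expR (- (sqnorm x / (8 * scale T i))))); last first.
  by rewrite powRM// ?(ltW r0)//; ring.
rewrite ler_pM2l ?powR_gt0//; apply: ler_pM; rewrite ?powR_ge0 ?expR_ge0//.
  by apply: powR_anti => //; rewrite divr_ge0.
rewrite ler_expR lerN2 ler_wpM2l ?sqnorm_ge0// lef_pV2 ?posrE ?mulr_gt0//; lra.
Qed.

(** The derivative of the switch is nonzero only while the kernel has age between [r] and [2 r],
    [r = scale T i]. This gives the Gaussian with [8 r], and differentiating the switch costs the
    extra [r^{-1}]. *)
Lemma source_le : exists2 C : R, 0 < C & forall T i x t, 0 < T ->
  source b T i x t <=
    C * (scale T i `^ (- s - 1) * expR (- (sqnorm x / (8 * scale T i)))).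
Proof.
have [C C0 HC] := @dchi_le R; exists C => // T i x t T0.
have r0 := scale_gt0 i T0; set r := scale T i in r0 *.
case: (boolP ((t <= onset T i + r) || (onset T i + 2 * r <= t))) => H.
  rewrite source_eq0// mulr_ge0 ?(ltW C0)// mulr_ge0 ?powR_ge0 ?expR_ge0//.
move: H; rewrite negb_or -!ltNge => /andP[t1 t2].
have st : onset T i < t by lra.
have tau0 : 0 < t - onset T i by rewrite subr_gt0.
rewrite /source kernE// -/r.
have -> : C * (r `^ (- s - 1) * expR (- (sqnorm x / (8 * r)))) =
    C / r * (r `^ b * (r `^ (- (n%:R / 2)) * expR (- (sqnorm x / (8 * r))))).
  rewrite powRB1// (_ : - s = b + - (n%:R / 2)); last by rewrite /b; ring.
  by rewrite powR_addp//; ring.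
apply: ler_pM.
- by rewrite divr_ge0 ?dchi_ge0 ?(ltW r0).
- by rewrite !mulr_ge0 ?powR_ge0 ?expR_ge0.
- by rewrite ler_pM2r ?invr_gt0.
rewrite ler_pM2l ?powR_gt0//; apply: ler_pM; rewrite ?powR_ge0 ?expR_ge0//.
  by apply: powR_anti => //; rewrite ?divr_ge0//; lra.
rewrite ler_expR lerN2 ler_wpM2l ?sqnorm_ge0// lef_pV2 ?posrE ?mulr_gt0//; lra.
Qed.

(** A Gaussian decays faster than any power, here of [max(|x|^2, r) / r]. The form is dictated by
    the lower bound [r^e q^{-M}] in [rhs_ge], from which it differs only by a power of [r] and a
    constant. *)
Lemma source_decay (M : R) : exists2 C : R, 0 < C & forall T i x t, 0 < T ->
  source b T i x t <= C * (scale T i `^ (M - s - 1) *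
    Num.max (sqnorm x) (scale T i) `^ (- M)).
Proof.
have [C C0 HC] := source_le.
have [D D0 HD] := @expR_decay R 8^-1 M ltac:(by []).
exists (C * (expR 8^-1 * D)) => [|T i x t T0]; first by rewrite !mulr_gt0 ?expR_gt0.
have r0 := scale_gt0 i T0; apply: le_trans (HC T i x t T0) _.
set r := scale T i in r0 *; set q := Num.max _ _.
have q0 : 0 < q by rewrite lt_max r0 orbT.
rewrite -mulrA ler_pM2l//.
have z1 : 1 <= q / r by rewrite ler_pdivlMr// mul1r le_max lexx orbT.
have := HD _ z1; rewrite powRM ?invr_ge0 ?(ltW q0) ?(ltW r0)//.
rewrite -[r^-1]powR_inv1 ?(ltW r0)// -powRrM mulN1r opprK => H.
have -> : r `^ (M - s - 1) = r `^ (- s - 1) * r `^ M.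
  by rewrite -powR_addp//; congr (_ `^ _); ring.
rewrite [leRHS](_ : _ = r `^ (- s - 1) *
   (expR 8^-1 * (D * (q `^ (- M) * r `^ M)))); last by ring.
rewrite ler_pM2l ?powR_gt0//.
apply: (@le_trans _ _ (expR 8^-1 * expR (- (8^-1 * (q * r `^ (-1)))))).
  rewrite -expRD ler_expR powR_inv1 ?(ltW r0)//.
  have -> : sqnorm x / (8 * r) = 8^-1 * (sqnorm x / r) by field; rewrite gt_eqF.
  have : q / r <= sqnorm x / r + 1.
    rewrite ler_pdivrMr// mulrDl mul1r divfK ?gt_eqF// ge_max lerDl lerDr.
    by rewrite (ltW r0) sqnorm_ge0.
  by lra.
by rewrite ler_pM2l ?expR_gt0.
Qed.

(** Induction on the number of kernels. If [|x|^2 <= r_i], the newest kernel alone supplies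
    [r_{i+1}^{-s}] up to a constant; otherwise passing from [r_i] to [r_{i+1}] leaves the maximum
    unchanged. At the start [r_0 = T/16], so [|x|^2 + T <= 17 max(|x|^2, r_0)]. *)
Lemma multiscale_ge (c : R) : 0 < c -> exists2 c0 : R, 0 < c0 & forall T i x, 0 < T ->
  c0 * Num.max (sqnorm x) (scale T i) `^ (- s) <=
  c * (sqnorm x + T) `^ (- s) + \sum_(k < i) 3 `^ (- (n%:R / 2)) *
    (scale T k `^ (- s) * expR (- (sqnorm x / (8 * scale T k)))).
Proof.
move=> c_gt0; pose a : R := 3 `^ (- (n%:R / 2)) * (4 `^ (- s) * expR (- 8^-1)).
have a0 : 0 < a by rewrite !mulr_gt0 ?powR_gt0 ?expR_gt0.
pose c0 := Num.min (c * 17 `^ (- s)) a.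
exists c0; first by rewrite lt_min a0 andbT mulr_gt0 ?powR_gt0.
have c00 : 0 < c0 by rewrite lt_min a0 andbT mulr_gt0 ?powR_gt0.
move=> T i x T0; elim: i => [|i IH].
  rewrite big_ord0 addr0 scale0; set q := Num.max _ _.
  have q0 : 0 < q by rewrite lt_max divr_gt0 ?orbT.
  apply: (@le_trans _ _ (c * 17 `^ (- s) * q `^ (- s))).
    by rewrite ler_pM2r ?powR_gt0// ge_min lexx.
  rewrite -mulrA ler_pM2l// -powRM ?(ltW q0)//; apply: powR_anti; rewrite ?(ltW s_gt0)//.
    by rewrite ltr_wpDl ?sqnorm_ge0.
  have : sqnorm x <= q by rewrite le_max lexx.
  have : T / 16 <= q by rewrite le_max lexx orbT.
  by lra.
have r0 := scale_gt0 i T0; have r1 := scale_gt0 i.+1 T0.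
case: (leP (sqnorm x) (scale T i)) => xr.
  apply: (@le_trans _ _ (3 `^ (- (n%:R / 2)) *
    (scale T i `^ (- s) * expR (- (sqnorm x / (8 * scale T i)))))); last first.
    rewrite big_ord_recr /= addrA lerDr addr_ge0//.
      by rewrite mulr_ge0 ?powR_ge0// ltW.
    by apply: sumr_ge0 => k _; rewrite !mulr_ge0 ?powR_ge0 ?expR_ge0.
  apply: (@le_trans _ _ (a * (scale T i / 4) `^ (- s))).
    apply: ler_pM; rewrite ?powR_ge0 ?(ltW c00)//; first by rewrite ge_min lexx orbT.
    apply: powR_anti; rewrite ?(ltW s_gt0) ?divr_gt0// -scaleS.
    by rewrite le_max lexx orbT.
  rewrite /a powRM ?(ltW r0)// -[4^-1]powR_inv1// -powRrM mulN1r opprK -!mulrA.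
  rewrite ler_pM2l ?powR_gt0// [leLHS](_ : _ = scale T i `^ (- s) * expR (- 8^-1)
     * (4 `^ (- s) * 4 `^ s)); last by ring.
  rewrite -powR_addp// addNr powRr0 mulr1 ler_pM2l ?powR_gt0// ler_expR lerN2.
  by rewrite ler_pdivrMr ?mulr_gt0//; lra.
have -> : Num.max (sqnorm x) (scale T i.+1) = Num.max (sqnorm x) (scale T i).
  rewrite !max_l ?(ltW xr)// scaleS; lra.
apply: le_trans IH _; rewrite lerD2l big_ord_recr /= lerDl.
by rewrite !mulr_ge0 ?powR_ge0 ?expR_ge0.
Qed.

Lemma sum_scale_le : exists2 B : R, 0 < B & forall T N, 0 < T ->
  \sum_(i < N) scale T i `^ b <= B * T `^ b.
Proof.
pose k := 4 `^ (- b) : R; have k0 : 0 < k by rewrite powR_gt0.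
have k1 : k < 1.
  rewrite /k powRN invf_lt1 ?powR_gt0//.
  have := @gt0_ltr_powR R b b_gt0 1 4; rewrite powR1; apply; rewrite ?nnegrE//.
  by rewrite ltr1n.
exists (1 - k)^-1 => [|T N T0]; first by rewrite invr_gt0 subr_gt0.
apply: (@le_trans _ _ (\sum_(i < N) k ^+ i * T `^ b)).
  apply: ler_sum => i _; rewrite /k -powR_mulrn ?powR_ge0// -powRrM.
  rewrite /scale powRM ?invr_ge0 ?exprn_ge0 ?(ltW T0)// mulrC ler_pM2r ?powR_gt0//.
  rewrite -powR_invn// -!powRrM; apply: ler_powR; first by rewrite ler1n.
  rewrite [leLHS]mulNr [leRHS]mulNr lerN2 [leLHS]mulrC.
  by apply: ler_wpM2r; [exact: ltW|rewrite ler_nat leqW].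
rewrite -mulr_suml ler_pM2r ?powR_gt0//; by rewrite geometric_sum_le// k0.
Qed.

End estimates.

(** * Switching off, summable kernel bounds and the background *)

Section estimates2.
Set Implicit Arguments.
Unset Strict Implicit.
Context {R : realType} {n : nat}.
Implicit Types (x y : 'rV[R]_n) (t T : R).
Variable s : R.
Hypotheses (s_gt0 : 0 < s) (s_lt : s < n%:R / 2).
Let b : R := n%:R / 2 - s.

Let b_gt0 : 0 < b. Proof. by rewrite subr_gt0. Qed.

(** Switching off happens for [2 T < t < 4 T], when all kernels have ages between [t/2] and [t] and
    total mass at most of order [T^b]. Together they are bounded by one Gaussian of age [t], the
    shape of the lower bound in [bgheat_ge] that absorbs them. *)
Lemma switch_off_le : exists2 C : R, 0 < C & forall T N x t, 0 < T ->
  dchi (t / (2 * T)) / (2 * T) * \sum_(i < N) piece b T i x t <=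
    C * (t `^ (- s - 1) * expR (- (sqnorm x / (4 * t)))).
Proof.
have [C C0 HC] := @dchi_le R; have [B B0 HB] := sum_scale_le s_lt.
pose K := 2 * C * B * 2^-1 `^ (- (n%:R / 2)).
have K0 : 0 < K by rewrite !mulr_gt0 ?powR_gt0 ?invr_gt0.
exists K => // T N x t T0.
case: (boolP ((t / (2 * T) <= 1) || (2 <= t / (2 * T)))) => H.
  by rewrite dchi_eq0// !mul0r !mulr_ge0 ?powR_ge0 ?expR_ge0// ltW.
move: H; rewrite negb_or -!ltNge => /andP[].
rewrite ltr_pdivlMr ?ltr_pdivrMr ?mulr_gt0// mul1r => t1 t2.
have t0 : 0 < t by lra.
have P i : piece b T i x t <= scale T i `^ b *
    (2^-1 `^ (- (n%:R / 2)) * t `^ (- (n%:R / 2)) * expR (- (sqnorm x / (4 * t)))).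
  have r0 := scale_gt0 i T0; have r16 := scale_le16 i T0.
  have st : onset T i < t by rewrite /onset; lra.
  have tau1 : t / 2 <= t - onset T i by rewrite /onset; lra.
  have tau2 : t - onset T i <= t by rewrite /onset; lra.
  have tau0 : 0 < t - onset T i by rewrite subr_gt0.
  rewrite /piece kernE// -[leRHS]mul1r; apply: ler_pM.
  - exact: chi_ge0.
  - by rewrite !mulr_ge0 ?powR_ge0 ?expR_ge0.
  - exact: chi_le1.
  - rewrite ler_pM2l ?powR_gt0// -powRM ?invr_ge0 ?(ltW t0)//.
    apply: ler_pM; rewrite ?powR_ge0 ?expR_ge0//.
      by apply: powR_anti; rewrite ?divr_ge0 ?mulr_gt0 ?invr_gt0//; lra.
    by rewrite ler_expR lerN2 ler_wpM2l ?sqnorm_ge0// lef_pV2 ?posrE ?mulr_gt0//; lra.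
have S : \sum_(i < N) piece b T i x t <= B * t `^ b *
    (2^-1 `^ (- (n%:R / 2)) * t `^ (- (n%:R / 2)) * expR (- (sqnorm x / (4 * t)))).
  apply: (@le_trans _ _ (\sum_(i < N) scale T i `^ b *
    (2^-1 `^ (- (n%:R / 2)) * t `^ (- (n%:R / 2)) * expR (- (sqnorm x / (4 * t)))))).
    by apply: ler_sum => i _; exact: P.
  rewrite -mulr_suml ler_pM2r ?mulr_gt0 ?powR_gt0 ?expR_gt0// ?invr_gt0//.
  apply: le_trans (HB T N T0) _; rewrite ler_pM2l//.
  by apply: powR_mono; rewrite ?(ltW T0) ?(ltW b_gt0)//; lra.
have D : dchi (t / (2 * T)) / (2 * T) <= 2 * C / t.
  apply: (@le_trans _ _ (C / (2 * T))).
    by rewrite ler_pM2r ?invr_gt0 ?mulr_gt0.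
  by rewrite ler_pdivrMr ?mulr_gt0// mulrAC ler_pdivlMr//; nra.
apply: (@le_trans _ _ (2 * C / t * (B * t `^ b *
    (2^-1 `^ (- (n%:R / 2)) * t `^ (- (n%:R / 2)) * expR (- (sqnorm x / (4 * t))))))).
  apply: ler_pM => //; first by rewrite divr_ge0 ?dchi_ge0// mulr_ge0// ltW.
  by apply: sumr_ge0 => i _; exact: piece_ge0.
rewrite powRB1// (_ : - s = b + - (n%:R / 2)); last by rewrite /b; ring.
by rewrite (powR_addp b _ t0) /K le_eqVlt; apply/orP; left; apply/eqP; ring.
Qed.

(** The mass splits as [r^{s1 - s} r^{n/2 - s1}]: the first factor is geometric in [i], the second
    is at most the same power of the age [tau >= r] and turns the kernel into [(|x|^2 + tau)^{-s1}].
    Raising [s] to [s1] pays for a sum over arbitrarily many kernels. *)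
Lemma piece_le (s1 : R) : s <= s1 -> s1 <= n%:R / 2 ->
  exists2 C : R, 0 < C & forall T i x t, 0 < T <= 1 ->
  piece b T i x t <= (4 `^ (- (s1 - s))) ^+ i *
    (if onset T i + scale T i <= t then C * (sqnorm x + (t - onset T i)) `^ (- s1) else 0).
Proof.
move=> ss1 s1n; have [D D0 HD] := @expR_decay R 4^-1 s1 ltac:(by []).
exists (D * expR 4^-1) => [|T i x t /andP[T0 T1]]; first by rewrite mulr_gt0 ?expR_gt0.
case: ifPn => [H|]; last first.
  by rewrite -ltNge => H; rewrite piece_eq0// ?mulr0// ltW.
have r0 := scale_gt0 i T0.
have st : onset T i < t by lra.
have tau0 : 0 < t - onset T i by rewrite subr_gt0.
have tau1 : scale T i <= t - onset T i by lra.
set tau := t - onset T i in tau0 tau1 *.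
rewrite /piece kernE// -/tau -[leRHS]mul1r; apply: ler_pM.
- exact: chi_ge0.
- by rewrite !mulr_ge0 ?powR_ge0 ?expR_ge0.
- exact: chi_le1.
have bE : b = (s1 - s) + (n%:R / 2 - s1) by rewrite /b; ring.
rewrite {1}bE powR_addp//.
have q0 : 0 < sqnorm x + tau by rewrite ltr_wpDl ?sqnorm_ge0.
have H1 : scale T i `^ (s1 - s) <= (4 `^ (- (s1 - s))) ^+ i.
  rewrite -powR_mulrn ?powR_ge0// -powRrM mulNr -mulrN mulrC powRrM.
  apply: powR_mono; rewrite ?(ltW r0) ?subr_ge0// powR_invn// /scale.
  rewrite ler_pdivrMr ?exprn_gt0// -(addn2 i) exprD mulrA mulVf ?expf_neq0// mul1r.
  by rewrite (le_trans T1)// exprn_ege1// ler1n.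
have H2 : scale T i `^ (n%:R / 2 - s1) <= tau `^ (n%:R / 2 - s1).
  by apply: powR_mono; rewrite ?(ltW r0)// subr_ge0.
have H3 : expR (- (sqnorm x / (4 * tau))) <=
    D * expR 4^-1 * ((sqnorm x + tau) `^ (- s1) * tau `^ s1).
  have z1 : 1 <= (sqnorm x + tau) / tau.
    by rewrite ler_pdivlMr// mul1r lerDr sqnorm_ge0.
  have := HD _ z1; rewrite powRM ?invr_ge0 ?(ltW q0) ?(ltW tau0)//.
  rewrite -[X in _ <= D * (_ * X `^ _)]powR_inv1 ?(ltW tau0)// -powRrM mulN1r opprK => h.
  rewrite mulrAC.
  have -> : - (sqnorm x / (4 * tau)) = - (4^-1 * ((sqnorm x + tau) / tau)) + 4^-1.
    by field; rewrite gt_eqF.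
  by rewrite expRD ler_pM2r ?expR_gt0.
apply: (@le_trans _ _ ((4 `^ (- (s1 - s))) ^+ i * tau `^ (n%:R / 2 - s1) *
  (tau `^ (- (n%:R / 2)) * (D * expR 4^-1 * ((sqnorm x + tau) `^ (- s1) * tau `^ s1))))).
  apply: ler_pM.
  - by rewrite mulr_ge0 ?powR_ge0.
  - by rewrite mulr_ge0 ?powR_ge0 ?expR_ge0.
  - by apply: ler_pM; rewrite ?powR_ge0.
  - by rewrite ler_pM2l ?powR_gt0.
have E : tau `^ (n%:R / 2 - s1) * tau `^ (- (n%:R / 2)) * tau `^ s1 = 1.
  by rewrite -!powR_addp// -[RHS](powRr0 tau); congr (_ `^ _); ring.
rewrite [leLHS](_ : _ = (tau `^ (n%:R / 2 - s1) * tau `^ (- (n%:R / 2)) * tau `^ s1) *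
  ((4 `^ (- (s1 - s))) ^+ i * (D * expR 4^-1 * (sqnorm x + tau) `^ (- s1)))); last by ring.
by rewrite E mul1r.
Qed.

Section background.
Variables (G : nat -> R -> R) (c C : R) (m : nat).
Hypotheses (HG : forall z, 1 <= z -> c * z `^ (- s) <= G 0%N z <= C * z `^ (- s)).

Lemma background_bounds x t : 0 < t ->
  c * (sqnorm x + t) `^ (- s) <= selfsim 0 s G x t <= C * (sqnorm x + t) `^ (- s).
Proof.
move=> t0; rewrite /selfsim subr0.
have z1 : 1 <= 1 + sqnorm x / t by rewrite lerDl divr_ge0 ?sqnorm_ge0// ltW.
have -> : (sqnorm x + t) `^ (- s) = t `^ (- s) * (1 + sqnorm x / t) `^ (- s).
  rewrite -powRM ?(ltW t0) ?(le_trans ler01 z1)//; congr (_ `^ _).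
  by field; rewrite gt_eqF.
have /andP[H1 H2] := HG z1.
by rewrite !(mulrCA _ (t `^ _)) !ler_pM2l ?powR_gt0// H1.
Qed.

Hypothesis HG2 : forall z, 1 <= z ->
  c * expR (- ((z - 1) / 4)) <= ssheat n s G z <= C * z `^ (- s - m%:R).

Definition bgheat x t : R := t `^ (- s - 1) * ssheat n s G (1 + sqnorm x / t).

Lemma bgheat_ge x t : 0 < t ->
  c * (t `^ (- s - 1) * expR (- (sqnorm x / (4 * t)))) <= bgheat x t.
Proof.
move=> t0; have z1 : 1 <= 1 + sqnorm x / t by rewrite lerDl divr_ge0 ?sqnorm_ge0// ltW.
have /andP[H1 _] := HG2 z1; rewrite mulrCA ler_pM2l ?powR_gt0//.
apply: le_trans H1; rewrite le_eqVlt; apply/orP; left; apply/eqP; congr (_ * expR _).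
by field; rewrite gt_eqF.
Qed.

(** Here the order [m] of the expansion is spent: it allows decay with the exponent [M] of the right
    side. *)
Lemma bgheat_le (M : R) x t : 0 < t -> 0 <= C -> M <= s + m%:R ->
  bgheat x t <= C * (t `^ (M - s - 1) * (sqnorm x + t) `^ (- M)).
Proof.
move=> t0 C0 Mm; have z1 : 1 <= 1 + sqnorm x / t by rewrite lerDl divr_ge0 ?sqnorm_ge0// ltW.
have q0 : 0 < sqnorm x + t by rewrite ltr_wpDl ?sqnorm_ge0.
have /andP[_ H1] := HG2 z1.
have -> : t `^ (M - s - 1) = t `^ (- s - 1) * t `^ M.
  by rewrite -powR_addp//; congr (_ `^ _); ring.
have E : t `^ M * (sqnorm x + t) `^ (- M) = (1 + sqnorm x / t) `^ (- M).
  have -> : 1 + sqnorm x / t = (sqnorm x + t) * t^-1 by field; rewrite gt_eqF.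
  rewrite powRM ?invr_ge0 ?(ltW q0) ?(ltW t0)// -[t^-1]powR_inv1 ?(ltW t0)//.
  by rewrite -powRrM mulN1r opprK mulrC.
rewrite /bgheat -mulrA E mulrCA ler_pM2l ?powR_gt0//.
apply: le_trans H1 _; rewrite ler_wpM2l// ler_powR//; lra.
Qed.

End background.
End estimates2.

(** * The differential inequality *)

Section differential_inequality.
Set Implicit Arguments.
Unset Strict Implicit.
Context {R : realType} {n : nat}.
Implicit Types (x y : 'rV[R]_n) (t T : R) (u : 'rV[R]_n -> R -> R).
Variables (alpha lambda sigma s : R).
Hypotheses (n_gt0 : (0 < n)%N) (alpha_gt0 : 0 < alpha) (lambda_gt1 : 1 < lambda)
  (sigma_ge0 : 0 <= sigma) (s_gt0 : 0 < s) (s_lt : s < n%:R / 2).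
Let e : R := (n%:R + 2 - alpha) / 2.
Let M : R := s * (lambda + sigma).
Hypothesis D_gt0 : 0 < M - s - 1 - e.
Let b : R := n%:R / 2 - s.
Let lambda_gt0 : 0 < lambda. Proof. exact: lt_trans lambda_gt1. Qed.

Definition rhs u x t : \bar R :=
  (STint (fun y s => (Phi (x - y) (t - s) `^ (alpha / n%:R) * u y s `^ lambda)%:E)
    * (u x t `^ sigma)%:E)%E.

(** The nonlocal factor contributes [q^{-s lambda}] and the local one [q^{-s sigma}], together
    [q^{-M}]. The constant [k] leaves room for the variation of [|y|^2] over the cube around [x]. *)
Lemma rhs_ge (k : R) : 0 < k -> exists2 c : R, 0 < c & forall u x t (r q A : R),
  0 < r -> 0 < t - 2 * r -> t < 1 -> 0 < q -> 0 < A ->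
  (forall y v, (forall k, `|y ord0 k - x ord0 k| <= r `^ 2^-1) ->
     t - 2 * r <= v <= t - r -> A * (k * q) `^ (- s) <= u y v) ->
  A * q `^ (- s) <= u x t ->
  ((c * (A `^ (lambda + sigma) * (r `^ e * q `^ (- M))))%:E <= rhs u x t)%E.
Proof.
move=> k0; have [cN cN0 HN] := @nonlocal_ge R n alpha lambda n_gt0 alpha_gt0 lambda_gt0.
exists (cN * (k `^ (- s)) `^ lambda) => [|u x t r q A r0 tr t1 q0 A0 Hy Hx].
  by rewrite mulr_gt0 ?powR_gt0.
have kq0 : 0 < k * q by rewrite mulr_gt0.
have L0 : 0 <= A * (k * q) `^ (- s) by rewrite mulr_ge0 ?powR_ge0// ltW.
have := HN u x t r _ r0 tr t1 L0 Hy; rewrite -/e => H.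
have -> : cN * k `^ (- s) `^ lambda * (A `^ (lambda + sigma) * (r `^ e * q `^ (- M))) =
   cN * r `^ e * (A * (k * q) `^ (- s)) `^ lambda * (A * q `^ (- s)) `^ sigma.
  rewrite (powR_addp lambda sigma A0) (powRM _ (ltW k0) (ltW q0)).
  rewrite !powRM ?mulr_ge0 ?powR_ge0 ?(ltW A0)//.
  have -> : q `^ (- M) = q `^ (- s) `^ lambda * q `^ (- s) `^ sigma.
    by rewrite -!powRrM -powR_addp//; congr (_ `^ _); rewrite /M; ring.
  by ring.
rewrite EFinM; apply: lee_pmul => //.
- by rewrite lee_fin !mulr_ge0 ?powR_ge0// ltW.
- by rewrite lee_fin powR_ge0.
- by rewrite lee_fin; apply: powR_mono; rewrite ?mulr_ge0 ?powR_ge0// ltW.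
Qed.

Lemma sqnorm_box x y (r : R) : 0 < r ->
  (forall k, `|y ord0 k - x ord0 k| <= r `^ 2^-1) ->
  sqnorm y <= 2 * sqnorm x + 2 * n%:R * r.
Proof.
move=> r0 H; have q0 : 0 < r `^ 2^-1 by rewrite powR_gt0.
have q2 : (r `^ 2^-1) ^+ 2 = r.
  by rewrite -powR_mulrn ?ltW// -powRrM mulVf ?powRr1// ltW.
have -> : 2 * sqnorm x + 2 * n%:R * r = \sum_(i < n) (2 * x ord0 i ^+ 2 + 2 * r).
  by rewrite big_split /= -mulr_sumr sumr_const card_ord -[(2 * r) *+ n]mulr_natl /sqnorm; ring.
apply: ler_sum => k _.
have : (y ord0 k - x ord0 k) ^+ 2 <= r.
  by rewrite -q2 -real_normK ?num_real// lerXn2r ?nnegrE ?(ltW q0).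
have := sqr_ge0 (y ord0 k - 2 * x ord0 k); nra.
Qed.

Section background.
Variables (G : nat -> R -> R) (c C : R) (m : nat).
Hypotheses (c_gt0 : 0 < c) (C_gt0 : 0 < C)
  (HG : forall z, 1 <= z -> c * z `^ (- s) <= G 0%N z <= C * z `^ (- s))
  (HG2 : forall z, 1 <= z ->
    c * expR (- ((z - 1) / 4)) <= ssheat n s G z <= C * z `^ (- s - m%:R))
  (Mm : M <= s + m%:R).

Lemma background_rhs : exists2 K0 : R, 0 < K0 & forall (K : R) u, K0 <= K ->
  (forall y t, 0 < t < 1 -> K * selfsim 0 s G y t <= u y t) ->
  forall x t, 0 < t < 1 -> ((2 * (K * bgheat s G x t))%:E <= rhs u x t)%E.
Proof.
have [c1 c10 H1] := @rhs_ge (2 + 2 * n%:R) ltac:(by rewrite ltr_wpDr).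
pose B := 2 * C / (c1 * c `^ (lambda + sigma) * 4^-1 `^ e).
have B0 : 0 < B by rewrite !mulr_gt0 ?invr_gt0 ?mulr_gt0 ?powR_gt0 ?invr_gt0.
have ls : 0 < lambda + sigma - 1 by rewrite subr_gt0 (lt_le_trans lambda_gt1)// lerDl.
pose K0 := B `^ (lambda + sigma - 1)^-1.
have K00 : 0 < K0 by rewrite powR_gt0.
exists K0 => // K u KK Hu x t /andP[t0 t1].
have K_gt0 : 0 < K by apply: lt_le_trans KK.
have q0 : 0 < sqnorm x + t by rewrite ltr_wpDl ?sqnorm_ge0.
have low y v : 0 < v < 1 -> K * c * (sqnorm y + v) `^ (- s) <= u y v.
  move=> v01; apply: le_trans (Hu y v v01); rewrite -mulrA ler_pM2l//.
  by case/andP: v01 => v0 _; have /andP[] := background_bounds HG y v0.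
refine (le_trans _ (H1 u x t (t / 4) (sqnorm x + t) (K * c) _ _ _ _ _ _ _)); last first.
- by apply: low; rewrite t0.
- move=> y v Hy Hv; have v0 : 0 < v by lra.
  have v01 : 0 < v < 1 by apply/andP; split => //; lra.
  apply: le_trans (low y v v01); rewrite ler_pM2l ?mulr_gt0//.
  apply: powR_anti; rewrite ?(ltW s_gt0)//; first by rewrite ltr_wpDl ?sqnorm_ge0.
  have := sqnorm_box (divr_gt0 t0 (ltr0n R 4 : 0 < 4)) Hy.
  have : 0 <= n%:R * t by rewrite mulr_ge0// ltW.
  have : 0 <= n%:R * sqnorm x by rewrite mulr_ge0// sqnorm_ge0.
  nra.
- by rewrite mulr_gt0.
- exact: q0.
- exact: t1.
- by lra.
- by rewrite divr_gt0.
rewrite lee_fin.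
have := bgheat_le HG2 x t0 (ltW C_gt0) Mm => HB.
apply: (@le_trans _ _ (2 * (K * (C * (t `^ (M - s - 1) * (sqnorm x + t) `^ (- M)))))).
  by rewrite ler_pM2l// ler_pM2l.
have tD : t `^ (M - s - 1) <= t `^ e.
  by apply: ger_powR; [rewrite t0 ltW|have := D_gt0; lra].
have KB : B * K <= K `^ (lambda + sigma).
  have -> : lambda + sigma = (lambda + sigma - 1) + 1 by ring.
  rewrite powR_addp// powRr1 ?(ltW K_gt0)// ler_pM2r//.
  have -> : B = K0 `^ (lambda + sigma - 1).
    by rewrite -powRrM mulVf ?gt_eqF// powRr1// ltW.
  by apply: powR_mono; rewrite ?(ltW K00) ?(ltW ls).
rewrite (powRM _ (ltW K_gt0) (ltW c_gt0)) (powRM _ (ltW t0)) ?invr_ge0//.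
pose Z := c1 * c `^ (lambda + sigma) * 4^-1 `^ e.
have Z0 : 0 < Z by rewrite !mulr_gt0 ?powR_gt0 ?invr_gt0.
have BZ : B * Z = 2 * C by rewrite /B divfK// gt_eqF.
set Q := (sqnorm x + t) `^ (- M); have Q0 : 0 < Q by rewrite powR_gt0.
rewrite [leRHS](_ : _ = K `^ (lambda + sigma) * (Z * t `^ e * Q)); last by rewrite /Z; ring.
rewrite [leLHS](_ : _ = B * K * (Z * t `^ (M - s - 1) * Q)); last first.
  rewrite (_ : B * K * (Z * t `^ (M - s - 1) * Q) = B * Z * (K * t `^ (M - s - 1) * Q)).
    by rewrite BZ; ring.
  by ring.
apply: ler_pM => //.
- by rewrite mulr_ge0 ?(ltW B0) ?(ltW K_gt0).
- by rewrite mulr_ge0 ?(ltW Q0)// mulr_ge0 ?powR_ge0 ?(ltW Z0).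
- by rewrite ler_pM2r// ler_pM2l.
Qed.

End background.

(** Source and right side differ by [r^D] with [D > 0], which beats the constants once [T], hence
    [r], is small. The lower bound on [u] is asked from [T - 4 r] on, since the cylinder below a
    time [t >= T - 2 r] reaches down by another [2 r]. *)
Lemma source_rhs (c0 : R) : 0 < c0 -> exists2 Ts : R, 0 < Ts & forall u T i x t,
  0 < T <= Ts -> T < 1 ->
  (forall y v, T - 4 * scale T i <= v <= T - scale T i ->
     c0 * Num.max (sqnorm y) (scale T i) `^ (- s) <= u y v) ->
  T - 2 * scale T i <= t <= T - scale T i ->
  ((2 * source b T i x t)%:E <= rhs u x t)%E.
Proof.
move=> c00; have [C C0 HC] := @source_decay R n s M.
have [c1 c10 H1] := @rhs_ge (2 + 2 * n%:R) ltac:(by rewrite ltr_wpDr).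
pose B := c1 * c0 `^ (lambda + sigma) / (2 * C).
have B0 : 0 < B by rewrite divr_gt0 ?mulr_gt0 ?powR_gt0.
pose D := M - s - 1 - e.
exists (B `^ D^-1) => [|u T i x t /andP[T0 TB] T1 Hu Ht]; first by rewrite powR_gt0.
have r0 := scale_gt0 i T0; have r16 := scale_le16 i T0.
set r := scale T i in r0 r16 Hu Ht *.
pose q := Num.max (sqnorm x) r.
have qr : r <= q by rewrite le_max lexx orbT.
have qx : sqnorm x <= q by rewrite le_max lexx.
have q0 : 0 < q by apply: lt_le_trans qr.
refine (le_trans _ (H1 u x t r q c0 _ _ _ _ _ _ _)) => //; last first.
- by apply: Hu; apply/andP; split; lra.
- move=> y v Hy Hv.
  have Hv' : T - 4 * r <= v <= T - r by apply/andP; split; lra.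
  apply: le_trans (Hu y v Hv'); rewrite ler_pM2l//.
  apply: powR_anti; rewrite ?(ltW s_gt0)//; first by rewrite lt_max r0 orbT.
  have := sqnorm_box r0 Hy => Hb; rewrite ge_max; apply/andP; split.
    apply: le_trans Hb _; rewrite [leRHS]mulrDl lerD//; first by rewrite ler_pM2l.
    by rewrite ler_wpM2l// mulr_ge0.
  apply: le_trans qr _; rewrite ler_peMl ?(ltW q0)//.
  by have := ler0n R n; lra.
- by lra.
- by lra.
rewrite lee_fin.
apply: (@le_trans _ _ (2 * (C * (r `^ (M - s - 1) * q `^ (- M))))).
  by rewrite ler_pM2l// HC.
have rD : r `^ D <= B.
  have -> : B = (B `^ D^-1) `^ D.
    by rewrite -powRrM mulVf ?gt_eqF// powRr1// ltW.
  by apply: powR_mono; rewrite ?(ltW r0) ?(ltW D_gt0)//; lra.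
have -> : r `^ (M - s - 1) = r `^ D * r `^ e.
  by rewrite -powR_addp//; congr (_ `^ _); rewrite /D; ring.
have BC : B * (2 * C) = c1 * c0 `^ (lambda + sigma).
  by rewrite divfK// mulf_neq0// gt_eqF.
rewrite (mulrA c1) -BC.
rewrite [leLHS](_ : _ = r `^ D * (2 * C) * (r `^ e * q `^ (- M))); last by ring.
rewrite ler_pM2r ?mulr_gt0 ?powR_gt0// ler_pM2r// mulr_gt0//.
Qed.

End differential_inequality.

(** * Integrability *)

Section Lp_bound.
Set Implicit Arguments.
Unset Strict Implicit.
Context {R : realType} {n : nat}.
Implicit Types (x y : 'rV[R]_n) (t T : R) (u : 'rV[R]_n -> R -> R).

(** A crude substitute for the Hoelder inequality: each [z i] is at most the [l^lambda] norm of [z],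
    and the weights sum to at most [1 / (1 - k)], so the constant is independent of [N]. *)
Lemma powR_geometric_sum (k lambda : R) N (z : 'I_N -> R) :
  0 < k < 1 -> 0 < lambda -> (forall i, 0 <= z i) ->
  (\sum_(i < N) k ^+ i * z i) `^ lambda <=
    (1 - k)^-1 `^ lambda * \sum_(i < N) z i `^ lambda.
Proof.
move=> k01 l0 z0; pose S := \sum_(i < N) z i `^ lambda.
have /andP[k0 k1] := k01; have k1' : 0 <= (1 - k)^-1 by rewrite invr_ge0 subr_ge0 ltW.
have S0 : 0 <= S by apply: sumr_ge0 => i _; exact: powR_ge0.
have ln0 : lambda != 0 by rewrite gt_eqF.
have zS i : z i <= S `^ lambda^-1.
  rewrite -[leLHS]powRr1// -(mulfV ln0) powRrM; apply: powR_mono; rewrite ?powR_ge0//.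
    by rewrite /S (bigD1 i)//= lerDl sumr_ge0// => j _; exact: powR_ge0.
  by rewrite invr_ge0 ltW.
apply: (@le_trans _ _ (((1 - k)^-1 * S `^ lambda^-1) `^ lambda)); last first.
  by rewrite powRM ?powR_ge0// -powRrM mulVf// powRr1.
apply: powR_mono; rewrite ?(ltW l0)//.
  by apply: sumr_ge0 => i _; rewrite mulr_ge0// exprn_ge0// ltW.
apply: (@le_trans _ _ (\sum_(i < N) k ^+ i * S `^ lambda^-1)).
  by apply: ler_sum => i _; rewrite ler_wpM2l// exprn_ge0// ltW.
by rewrite -mulr_suml ler_wpM2r ?powR_ge0// geometric_sum_le.
Qed.

(** The power is split into [n] equal factors, and in each [|x|^2] is reduced to one coordinate;
    this yields the product form that [iint_le_prod] integrates coordinate by coordinate. *)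
Lemma powR_sqnorm_le_prod (p t : R) x : (0 < n)%N -> 0 <= p -> 0 < t ->
  (sqnorm x + t) `^ (- p) <= \prod_(k < n) (x ord0 k ^+ 2 + t) `^ (- (p / n%:R)).
Proof.
move=> n0 p0 t0; have nR : (n%:R : R) != 0 by rewrite pnatr_eq0 -lt0n.
have -> : (sqnorm x + t) `^ (- p) = \prod_(k < n) (sqnorm x + t) `^ (- (p / n%:R)).
  rewrite prodr_const card_ord -powR_mulrn ?powR_ge0// -powRrM.
  by congr (_ `^ _); field.
apply: ler_prod => k _; rewrite powR_ge0 /=; apply: powR_anti.
- by rewrite ltr_wpDl// sqr_ge0.
- by rewrite lerD2r /sqnorm (bigD1 k)//= lerDl sumr_ge0// => j _; exact: sqr_ge0.
- by rewrite divr_ge0.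
Qed.

Lemma iint_le_powers (p0 p1 : R) : (0 < n)%N -> n%:R / 2 < p0 -> n%:R / 2 < p1 ->
  exists2 C : R, 0 < C & forall N (a0 t0 : R) (a tau : 'I_N -> R)
      (f : 'rV[R]_n -> \bar R),
    0 <= a0 -> 0 < t0 -> (forall i, 0 <= a i) -> (forall i, 0 < tau i) ->
    (forall y, 0 <= f y)%E ->
    (forall y, f y <= (a0 * (sqnorm y + t0) `^ (- p0) +
       \sum_(i < N) a i * (sqnorm y + tau i) `^ (- p1))%:E)%E ->
    (iint f <= (C * (a0 * t0 `^ (n%:R / 2 - p0) +
       \sum_(i < N) a i * tau i `^ (n%:R / 2 - p1)))%:E)%E.
Proof.
move=> n0 hp0 hp1; have nR : (0 : R) < n%:R by rewrite ltr0n.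
have p0_ge0 : 0 <= p0 by apply: le_trans (ltW hp0); rewrite divr_ge0.
have p1_ge0 : 0 <= p1 by apply: le_trans (ltW hp1); rewrite divr_ge0.
have half (p : R) : n%:R / 2 < p -> 2^-1 < p / n%:R.
  by move=> h; rewrite ltr_pdivlMr// mulrC.
have [C0 C00 H0] := integral_japanese_bracket (half _ hp0).
have [C1 C10 H1] := integral_japanese_bracket (half _ hp1).
exists (C0 ^+ n + C1 ^+ n) => [|N a0 t0 a tau f a0_ge0 t0_gt0 a_ge0 tau_gt0 f0 Hf].
  by rewrite addr_gt0 ?exprn_gt0.
pose p (i : 'I_N.+1) := oapp (fun=> p1) p0 (unlift ord0 i).
pose th (i : 'I_N.+1) := oapp tau t0 (unlift ord0 i).
pose c (i : 'I_N.+1) := oapp a a0 (unlift ord0 i).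
pose D (i : 'I_N.+1) := oapp (fun=> C1) C0 (unlift ord0 i).
have th0 i : 0 < th i by rewrite /th; case: unlift.
have D0 i : 0 < D i by rewrite /D; case: unlift.
pose g (i : 'I_N.+1) (r : R) := (r ^+ 2 + th i) `^ (- (p i / n%:R)).
pose K (i : 'I_N.+1) := D i * th i `^ (2^-1 - p i / n%:R).
have H : (iint f <= (\sum_(i < N.+1) c i * K i ^+ n)%:E)%E.
  apply: (@iint_le_prod R n N.+1 f c g K) => //.
  - by move=> i; rewrite /c; case: unlift => /=.
  - by move=> i r; exact: powR_ge0.
  - move=> i; have -> : g i = (@powR R ^~ (- (p i / n%:R))) \o (fun r : R => r ^+ 2 + th i) by [].
    apply: measurableT_comp; first exact: measurable_powR.
    by apply: measurable_funD => //; exact: measurable_funX.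
  - by move=> i; rewrite mulr_ge0 ?powR_ge0 ?(ltW (D0 i)).
  - move=> i; rewrite /g /K /D /p /th; case: unlift => [j|] /=; [exact: H1|exact: H0].
  move=> y; apply: le_trans (Hf y) _; rewrite lee_fin big_ord_recl.
  apply: lerD.
    rewrite /g /c /p /th unlift_none /= ler_wpM2l//.
    exact: powR_sqnorm_le_prod.
  apply: ler_sum => i _; rewrite /g /c /p /th liftK /= ler_wpM2l//.
  exact: powR_sqnorm_le_prod.
apply: le_trans H _; rewrite lee_fin big_ord_recl mulrDr.
have KE i q : 0 < th i -> p i = q -> K i ^+ n = D i ^+ n * th i `^ (n%:R / 2 - q).
  move=> ti <-; rewrite /K exprMn -[in LHS](@powR_mulrn _ (_ `^ _)) ?powR_ge0//.
  by rewrite -powRrM; congr (_ * _ `^ _); field; rewrite gt_eqF.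
apply: lerD.
  rewrite (KE _ p0)//; last by rewrite /p unlift_none.
  rewrite /c /D /th unlift_none /= mulrCA ler_wpM2r ?mulr_ge0 ?powR_ge0//.
  by rewrite lerDl exprn_ge0// ltW.
rewrite mulr_sumr; apply: ler_sum => i _.
rewrite (KE _ p1)//; last by rewrite /p liftK.
rewrite /c /D /th liftK /= mulrCA ler_wpM2r ?mulr_ge0 ?powR_ge0//.
by rewrite lerDr exprn_ge0// ltW.
Qed.

End Lp_bound.

(** * Integration in time over all bursts *)

Section time_integral.
Set Implicit Arguments.
Unset Strict Implicit.
Context {R : realType}.

Definition pow_on (s a c g : R) : R -> \bar R :=
  (fun t : R => ((t - s) `^ (- g))%:E) \_ `[a, c].

Lemma pow_on_ge0 (s a c g t : R) : (0 <= pow_on s a c g t)%E.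
Proof. by rewrite /pow_on patchE; case: ifP => // _; rewrite lee_fin powR_ge0. Qed.

Lemma measurable_pow_on (s a c g : R) : measurable_fun setT (pow_on s a c g).
Proof.
apply: (measurable_restrictT _ _).1 => //; apply: measurable_funTS.
apply: measurableT_comp => //.
have -> : (fun t : R => (t - s) `^ (- g)) = (@powR R ^~ (- g)) \o (fun r : R => r - s) by [].
apply: measurableT_comp; first exact: measurable_powR.
exact: measurable_funB.
Qed.

Lemma integral_pow_on (s a c g : R) : 0 <= s -> s < a -> a < c -> g < 1 ->
  (\int[@lebesgue_measure R]_t pow_on s a c g t <= (c `^ (1 - g) / (1 - g))%:E)%E.
Proof.
move=> s0 sa ac g1; rewrite /pow_on -integral_mkcond.
apply: le_trans (integral_powR_shift sa ac g1) _; rewrite lee_fin.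
by rewrite ler_pM2r ?invr_gt0 ?subr_gt0//; apply: powR_mono; rewrite ?subr_ge0; lra.
Qed.

(** On each interval [[T0 / 16^j / 4, 16^-j]] the majorant is integrated explicitly as [P j]. The
    integral of [t^{-g}] up to [16^-j] is of order [16^{-j (1 - g)}], so the sum over [j] is
    geometric, as is the sum over the kernels; finiteness follows whatever the growth of [N]. *)
Lemma STint_lt_pinfty n (f : 'rV[R]_n -> R -> \bar R) (T0 A g g1 k : R) (N : nat -> nat) :
  0 < T0 <= 1 -> 0 <= A -> g < 1 -> g1 < 1 -> 0 < k < 1 ->
  (forall y t, 0 <= f y t)%E ->
  (forall t, 0 < t < 1 -> exists2 j, T0 / 16 ^+ j / 4 <= t <= 16 ^- j &
    (iint (fun y => f y t) <= (A * (t `^ (- g) + \sum_(i < N j) k ^+ i *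
      (if onset (T0 / 16 ^+ j) i + scale (T0 / 16 ^+ j) i <= t
       then (t - onset (T0 / 16 ^+ j) i) `^ (- g1) else 0)))%:E)%E) ->
  (STint f < +oo)%E.
Proof.
move=> /andP[T00 T01] A0 hg hg1 /andP[k0 k1] f0 Hf.
pose T j : R := T0 / 16 ^+ j; pose c j : R := 16 ^- j.
have p16 j : (0 : R) < 16 ^+ j by rewrite exprn_gt0.
have Tp j : 0 < T j by rewrite divr_gt0.
have cp j : 0 < c j by rewrite invr_gt0.
have Tc j : T j <= c j by rewrite /T /c ler_pdivrMr// mulVf// gt_eqF.
pose F0 j := pow_on 0 (T j / 4) (c j) g.
pose F j i := pow_on (onset (T j) i) (onset (T j) i + scale (T j) i) (c j) g1.
pose P j t := (A%:E * (F0 j t + \sum_(i < N j) (k ^+ i)%:E * F j i t))%E.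
have F0_ge0 j t : (0 <= F0 j t)%E by exact: pow_on_ge0.
have F_ge0 j i t : (0 <= (k ^+ i)%:E * F j i t)%E.
  by rewrite mule_ge0 ?pow_on_ge0// lee_fin exprn_ge0// ltW.
have S_ge0 j t : (0 <= \sum_(i < N j) (k ^+ i)%:E * F j i t)%E by exact: sume_ge0.
have P_ge0 j t : (0 <= P j t)%E by rewrite mule_ge0 ?lee_fin// adde_ge0.
have mF0 j : measurable_fun setT (F0 j) by exact: measurable_pow_on.
have mF j i : measurable_fun setT (fun t => (k ^+ i)%:E * F j i t)%E.
  by apply: measurable_funeM; exact: measurable_pow_on.
have mS j : measurable_fun setT (fun t => \sum_(i < N j) (k ^+ i)%:E * F j i t)%E.
  by apply: emeasurable_sum => i; exact: mF.
have mFS j : measurable_fun setT (fun t => F0 j t + \sum_(i < N j) (k ^+ i)%:E * F j i t)%E.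
  exact: emeasurable_funD.
have mP j : measurable_fun setT (P j) by exact: measurable_funeM.
have bound j : (\int[@lebesgue_measure R]_t P j t <=
    (A * (c j `^ (1 - g) / (1 - g) + (1 - k)^-1 * (c j `^ (1 - g1) / (1 - g1))))%:E)%E.
  rewrite /P ge0_integralZl//; [|exact: mFS|by move=> t _; rewrite adde_ge0].
  rewrite EFinM; apply: lee_pmul => //.
    by apply: integral_ge0 => t _; rewrite adde_ge0.
  have -> : (\int[@lebesgue_measure R]_t (F0 j t + \sum_(i < N j) (k ^+ i)%:E * F j i t) =
     (\int[@lebesgue_measure R]_t F0 j t) +
     (\int[@lebesgue_measure R]_t (\sum_(i < N j) (k ^+ i)%:E * F j i t)))%E.
    exact: (ge0_integralD (@lebesgue_measure R) measurableT (fun t _ => F0_ge0 j t) (mF0 j) (fun t _ => S_ge0 j t) (mS j)).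
  rewrite EFinD; apply: leeD.
    apply: integral_pow_on => //; first by rewrite divr_gt0.
    by apply: lt_le_trans (Tc j); have := Tp j; lra.
  have -> : (\int[@lebesgue_measure R]_t (\sum_(i < N j) (k ^+ i)%:E * F j i t) =
     \sum_(i < N j) \int[@lebesgue_measure R]_t ((k ^+ i)%:E * F j i t))%E.
    by apply: ge0_integral_sum => //= i; exact: mF.
  apply: (@le_trans _ _ (\sum_(i < N j) (k ^+ i * (c j `^ (1 - g1) / (1 - g1)))%:E)%E).
    apply: lee_sum => i _; rewrite ge0_integralZl//.
    - rewrite EFinM; apply: lee_pmul => //.
      + by rewrite lee_fin exprn_ge0// ltW.
      + by apply: integral_ge0 => t _; exact: pow_on_ge0.
      + have r0 := scale_gt0 i (Tp j); have r16 := scale_le16 i (Tp j).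
        have TT := Tp j; have Tcj := Tc j.
        apply: integral_pow_on => //; rewrite /onset; lra.
    - exact: measurable_pow_on.
    - by move=> t _; exact: pow_on_ge0.
    - by rewrite lee_fin exprn_ge0// ltW.
  rewrite sumEFin lee_fin -mulr_suml ler_wpM2r//.
    by rewrite divr_ge0 ?powR_ge0// subr_ge0 ltW.
  by rewrite geometric_sum_le// k0.
(* The single [j] that serves a given [t] is replaced by the whole series, which avoids a measurable
   choice of [j] as a function of [t]. *)
apply: (@le_lt_trans _ _ (\int[@lebesgue_measure R]_t (\sum_(j <oo) P j t)%E)%E).
  rewrite /STint integral_mkcond; apply: ge0_integral_mono => t _; rewrite patchE.
    by case: ifP => // _; apply: iint_ge0 => y.
  case: ifPn => [|_]; last exact: nneseries_ge0.
  rewrite inE /= in_itv /= => t01.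
  have [j Hj HH] := Hf t t01; apply: le_trans HH _.
  apply: (@le_trans _ _ (P j t)).
    rewrite /P EFinM; apply: lee_pmul => //.
      rewrite lee_fin addr_ge0 ?powR_ge0// sumr_ge0// => i _.
      by rewrite mulr_ge0 ?exprn_ge0 ?(ltW k0)//; case: ifP => // _; exact: powR_ge0.
    rewrite EFinD; apply: leeD.
      by rewrite /F0 /pow_on patchE ifT ?subr0// inE /= in_itv.
    rewrite -sumEFin; apply: lee_sum => i _; rewrite EFinM; apply: lee_pmul => //.
    - by rewrite lee_fin exprn_ge0// ltW.
    - by rewrite lee_fin; case: ifP => // _; exact: powR_ge0.
    - case: ifPn => H; last exact: pow_on_ge0.
      rewrite /F /pow_on patchE ifT// inE /= in_itv /= H.
      by case/andP: Hj.
  apply: le_trans (@nneseries_lim_ge R (P ^~ t) xpredT 0%N j.+1 _) => //.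
  by rewrite big_nat_recr//= leeDr// sume_ge0.
rewrite integral_nneseries//.
pose w0 : R := 16 `^ (- (1 - g)); pose w1 : R := 16 `^ (- (1 - g1)).
have w01 (h : R) : h < 1 -> 0 < (16 : R) `^ (- (1 - h)) < 1.
  move=> h1; rewrite powR_gt0//= powRN invf_lt1 ?powR_gt0//.
  have := @gt0_ltr_powR R (1 - h) _ 1 16; rewrite powR1; apply; rewrite ?nnegrE//.
    by rewrite subr_gt0.
  by rewrite ltr1n.
have cE h j : c j `^ (1 - h) = (16 `^ (- (1 - h))) ^+ j.
  rewrite /c -powR_invn// -powRrM -powR_mulrn ?powR_ge0// -powRrM.
  by congr (_ `^ _); ring.
pose B := A * ((1 - w0)^-1 / (1 - g) + (1 - k)^-1 * ((1 - w1)^-1 / (1 - g1))).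
apply: (@le_lt_trans _ _ B%:E); last exact: ltry.
apply: lime_le.
  by apply: is_cvg_nneseries => j _ _; exact: integral_ge0.
apply: nearW => m; rewrite big_mkord.
apply: (@le_trans _ _ (\sum_(j < m) (A * (c j `^ (1 - g) / (1 - g) +
    (1 - k)^-1 * (c j `^ (1 - g1) / (1 - g1))))%:E)%E).
  by apply: lee_sum => j _; exact: bound.
rewrite sumEFin lee_fin -mulr_sumr; apply: ler_wpM2l => //.
rewrite big_split /= -mulr_suml -mulr_sumr -mulr_suml; apply: lerD.
  rewrite ler_pM2r ?invr_gt0 ?subr_gt0//.
  under eq_bigr do rewrite cE.
  exact/geometric_sum_le/w01.
rewrite ler_pM2l ?invr_gt0 ?subr_gt0// ler_pM2r ?invr_gt0 ?subr_gt0//.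
under eq_bigr do rewrite cE.
exact/geometric_sum_le/w01.
Qed.

End time_integral.

(** * Choice of the exponents and spatial integral of the solution *)

Section Lp_of_solution.
Set Implicit Arguments.
Unset Strict Implicit.
Context {R : realType} {n : nat}.
Implicit Types (x y : 'rV[R]_n) (t T : R).

Lemma exponents_exist (alpha lambda sigma : R) : (0 < n)%N ->
  0 < alpha < n%:R + 2 -> (n%:R + 2) / n%:R <= lambda -> 0 <= sigma ->
  1 + (2 - alpha) / (n%:R + 2) * lambda < sigma ->
  1 < lambda /\ exists s s1 : R,
    [/\ 0 < s, s < s1, s1 < n%:R / 2, n%:R / 2 < s * lambda & s1 * lambda < n%:R / 2 + 1] /\
    0 < s * (lambda + sigma) - s - 1 - (n%:R + 2 - alpha) / 2.
Proof.
move=> n0 /andP[al0 al1] hl sg0 hs; have nR : (0 : R) < n%:R by rewrite ltr0n.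
have n2 : (0 : R) < n%:R + 2 by rewrite addr_gt0.
have l1 : 1 < lambda by apply: lt_le_trans hl; rewrite ltr_pdivlMr// mul1r ltrDl.
have l0 : 0 < lambda by exact: lt_trans l1.
split => //.
have ls : 0 < lambda + sigma - 1 by lra.
(* [H] is the upper limit imposed by time integrability; [L1] and [L2] are the lower limits imposed
   by space integrability and by the gap. [L2 < H] expresses the hypothesis on [sigma], [H <= n/2]
   the one on [lambda]. *)
pose H := (n%:R + 2) / (2 * lambda).
pose L1 := n%:R / (2 * lambda); pose L2 := (n%:R + 4 - alpha) / (2 * (lambda + sigma - 1)).
have Hn : H <= n%:R / 2.
  rewrite /H ler_pdivrMr ?mulr_gt0//; move: hl; rewrite ler_pdivrMr//; lra.
have L1H : L1 < H by rewrite ltr_pM2r ?invr_gt0 ?mulr_gt0// ltrDl.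
have L10 : 0 < L1 by rewrite divr_gt0 ?mulr_gt0.
have L2H : L2 < H.
  rewrite /L2 /H ltr_pdivrMr ?mulr_gt0// mulrAC ltr_pdivlMr ?mulr_gt0//.
  have : (2 - alpha) * lambda < (n%:R + 2) * (sigma - 1).
    have : (2 - alpha) / (n%:R + 2) * lambda < sigma - 1 by lra.
    by rewrite mulrAC ltr_pdivrMr// [X in _ < X]mulrC.
  nra.
pose L := Num.max L1 L2.
have LH : L < H by rewrite gt_max L1H.
have LL1 : L1 <= L by rewrite le_max lexx.
have LL2 : L2 <= L by rewrite le_max lexx orbT.
(* The two points that cut the interval from [L] to [H] into thirds. *)
exists ((2 * L + H) / 3), ((L + 2 * H) / 3); split; [split|].
- by lra.
- by lra.
- by lra.
- have : L1 < (2 * L + H) / 3 by lra.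
  by rewrite /L1 ltr_pdivrMr ?mulr_gt0//; lra.
- have : (L + 2 * H) / 3 < (n%:R + 2) / (2 * lambda) by rewrite -/H; lra.
  by rewrite ltr_pdivlMr ?mulr_gt0//; lra.
- have : L2 < (2 * L + H) / 3 by lra.
  by rewrite /L2 ltr_pdivrMr ?mulr_gt0//; lra.
Qed.

Lemma iint_solution_le (lambda s s1 K C : R) (G : nat -> R -> R) :
  (0 < n)%N -> 0 < lambda -> 0 < s -> s < s1 -> s1 < n%:R / 2 -> n%:R / 2 < s * lambda ->
  0 < K -> 0 < C ->
  (forall y t, 0 < t -> 0 <= selfsim 0 s G y t <= C * (sqnorm y + t) `^ (- s)) ->
  exists A k : R, [/\ 0 <= A, 0 < k < 1 & forall T N t, 0 < T <= 1 -> 0 < t ->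
    (iint (fun y => (`|K * selfsim 0 s G y t + burst (n%:R / 2 - s) T N y t| `^ lambda)%:E) <=
     (A * (t `^ (- (s * lambda - n%:R / 2)) + \sum_(i < N) k ^+ i *
      (if onset T i + scale T i <= t
       then (t - onset T i) `^ (- (s1 * lambda - n%:R / 2)) else 0)))%:E)%E].
Proof.
move=> n0 l0 s0 ss1 s1n snl K0 C0 HG.
have [C1 C10 HC1] := @piece_le R n s s1 (ltW ss1) (ltW s1n).
have s1nl : n%:R / 2 < s1 * lambda by apply: lt_trans snl _; rewrite ltr_pM2r.
have [C2 C20 HC2] := @iint_le_powers R n _ _ n0 snl s1nl.
(* [kap] is the square root of the rate in [piece_le]: one factor [kap^i] serves as weight in
   [powR_geometric_sum], the other survives the power as [(kap^lambda)^i] and makes the time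
   integrals summable. *)
pose kap : R := 2 `^ (- (s1 - s)).
have kap01 : 0 < kap < 1.
  rewrite /kap powR_gt0//= powRN invf_lt1 ?powR_gt0//.
  have := @gt0_ltr_powR R (s1 - s) _ 1 2; rewrite powR1; apply; rewrite ?nnegrE//.
    by rewrite subr_gt0.
  by rewrite ltr1n.
have /andP[kap0 kap1] := kap01.
have kap2 : 4 `^ (- (s1 - s)) = kap * kap.
  by rewrite /kap -powRM//; congr (_ `^ _); rewrite -natrM.
pose A1 := (1 - kap)^-1 `^ lambda.
have A10 : 0 <= A1 by exact: powR_ge0.
pose a0 := A1 * (K * C) `^ lambda; pose a1 := A1 * (kap^-1 * C1) `^ lambda.
have a00 : 0 <= a0 by rewrite mulr_ge0 ?powR_ge0.
have a10 : 0 <= a1 by rewrite mulr_ge0 ?powR_ge0.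
exists (C2 * (a0 + a1)), (kap `^ lambda); split.
- by rewrite mulr_ge0 ?addr_ge0// ltW.
- rewrite powR_gt0//=; have := @gt0_ltr_powR R lambda l0 kap 1; rewrite powR1; apply=> //;
    by rewrite nnegrE ?ltW.
move=> T N t T01 t0; have /andP[T0 T1] := T01.
pose act i := onset T i + scale T i <= t.
pose a (i : 'I_N) := if act i then a1 * (kap `^ lambda) ^+ i else 0.
(* The default [1] for a kernel not yet active keeps [tau] positive; its coefficient is zero. *)
pose tau (i : 'I_N) := if act i then t - onset T i else 1.
have act_gt0 i : act i -> 0 < t - onset T i.
  by rewrite /act; have := scale_gt0 i T0; lra.
have a_ge0 i : 0 <= a i by rewrite /a; case: ifP => // _; rewrite mulr_ge0// exprn_ge0 ?powR_ge0.
have tau_gt0 i : 0 < tau i by rewrite /tau; case: ifPn => // /act_gt0.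
apply: le_trans (HC2 N a0 t a tau _ a00 t0 a_ge0 tau_gt0 _ _) _.
- by move=> y; rewrite lee_fin powR_ge0.
- move=> y; rewrite lee_fin.
  have q0 : 0 < sqnorm y + t by rewrite ltr_wpDl ?sqnorm_ge0.
  (* Kernel [j] sits at index [j + 1], behind the background, so its weight is [kap^{j+1}]; the
     prefactor [kap^-1] compensates for the shift. *)
  pose z (i : 'I_N.+1) := oapp (fun j : 'I_N => kap^-1 * (kap ^+ j *
    (if act j then C1 * (sqnorm y + (t - onset T j)) `^ (- s1) else 0)))
    (K * C * (sqnorm y + t) `^ (- s)) (unlift ord0 i).
  have z0 i : 0 <= z i.
    rewrite /z; case: unlift => [j|] /=; last by rewrite !mulr_ge0 ?powR_ge0 ?ltW.
    rewrite !mulr_ge0 ?invr_ge0 ?exprn_ge0 ?(ltW kap0)//.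
    by case: ifP => // _; rewrite mulr_ge0 ?powR_ge0// ltW.
  have /andP[w0 w1] := HG y t t0.
  have U0 : 0 <= K * selfsim 0 s G y t + burst (n%:R / 2 - s) T N y t.
    by rewrite addr_ge0 ?burst_ge0// mulr_ge0// ltW.
  have UZ : K * selfsim 0 s G y t + burst (n%:R / 2 - s) T N y t <=
      \sum_(i < N.+1) kap ^+ i * z i.
    rewrite big_ord_recl expr0 mul1r /z unlift_none /=; apply: lerD.
      by rewrite -mulrA ler_pM2l.
    apply: (@le_trans _ _ (\sum_(i < N) piece (n%:R / 2 - s) T i y t)).
      rewrite /burst -[leRHS]mul1r; apply: ler_wpM2r.
        by apply: sumr_ge0 => i _; exact: piece_ge0.
      by rewrite gerBl chi_ge0.
    apply: ler_sum => i _; rewrite liftK /=; apply: le_trans (HC1 T i y t T01) _.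
    rewrite kap2 exprMn /bump /= add1n exprS -/(act i).
    rewrite le_eqVlt; apply/orP; left; apply/eqP; field.
    by rewrite gt_eqF.
  rewrite ger0_norm//; apply: (@le_trans _ _ ((\sum_(i < N.+1) kap ^+ i * z i) `^ lambda)).
    by apply: powR_mono => //; exact: ltW.
  apply: le_trans (powR_geometric_sum kap01 l0 z0) _.
  rewrite -/A1 mulr_sumr big_ord_recl; apply: lerD.
    rewrite /z unlift_none /= powRM ?powR_ge0 ?mulr_ge0 ?(ltW K0) ?(ltW C0)//.
    by rewrite /a0 -mulrA -powRrM mulNr.
  apply: ler_sum => i _; rewrite /z liftK /= /a /tau; case: ifPn => [/act_gt0 ti|_]; last first.
    by rewrite !mulr0 powR0 ?mulr0 ?mul0r// gt_eqF.
  have Q0 : 0 < sqnorm y + (t - onset T i) by rewrite ltr_wpDl ?sqnorm_ge0.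
  rewrite [X in A1 * X `^ _](_ : _ = (kap^-1 * C1) * (kap ^+ i * (sqnorm y + (t - onset T i)) `^ (- s1))); last by ring.
  rewrite !powRM ?mulr_ge0 ?powR_ge0 ?invr_ge0 ?exprn_ge0 ?(ltW kap0) ?(ltW C10)//.
  rewrite -[X in _ <= _ * X]/(_ `^ (- (s1 * lambda))).
  rewrite -(powRrM (sqnorm y + _)) mulNr.
  have -> : (kap ^+ i) `^ lambda = (kap `^ lambda) ^+ i.
    rewrite -(powR_mulrn _ (ltW kap0)) -(powR_mulrn _ (powR_ge0 kap lambda)) -!(powRrM kap).
    by congr (_ `^ _); exact: mulrC.
  rewrite /a1 powRM ?invr_ge0 ?(ltW kap0) ?(ltW C10)//.
  by rewrite le_eqVlt; apply/orP; left; apply/eqP; ring.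
rewrite lee_fin -mulrA ler_pM2l// mulrDr; apply: lerD.
  rewrite opprB; apply: ler_wpM2r; first exact: powR_ge0.
  by rewrite lerDl.
rewrite mulr_sumr; apply: ler_sum => i _; rewrite /a /tau -/(act i).
case: ifPn => [/act_gt0 ti|_]; last by rewrite mul0r !mulr0.
rewrite (opprB (s1 * lambda)) [leRHS]mulrA; apply: ler_wpM2r; first exact: powR_ge0.
by apply: ler_wpM2r; [rewrite exprn_ge0// powR_ge0|rewrite lerDr].
Qed.

End Lp_of_solution.

(** * The solution *)

Section glueing.
Set Implicit Arguments.
Unset Strict Implicit.
Context {R : realType} {n : nat}.
Implicit Types (x y : 'rV[R]_n) (t : R).

Lemma exp16_unbounded (a : R) : exists j, a < 16 ^+ j.
Proof.
exists (Num.truncn `|a|).+1; apply: le_lt_trans (ler_norm a) _.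
apply: lt_le_trans (truncnS_gt _) _.
by rewrite -natrX ler_nat ltnW// ltn_expl.
Qed.

Variables (s : R) (K : R) (G : nat -> R -> R) (T0 : R) (N : nat -> nat).
Hypotheses (TG : tower [set z : R | 0 < z] G) (T0_gt0 : 0 < T0).
Let b : R := n%:R / 2 - s.

Definition peak j : R := T0 / 16 ^+ j.

Lemma peak_gt0 j : 0 < peak j.
Proof. by rewrite divr_gt0// exprn_gt0. Qed.

Lemma peakS j : peak j = 16 * peak j.+1.
Proof.
rewrite /peak exprS; field; by rewrite expf_neq0.
Qed.

Lemma peak_le i j : (i <= j)%N -> peak j <= peak i.
Proof.
elim: j => [|j IH]; first by rewrite leqn0 => /eqP ->.
rewrite leq_eqVlt => /orP[/eqP ->//|ij]; apply: le_trans (IH ij).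
by rewrite [leRHS]peakS; have := peak_gt0 j.+1; lra.
Qed.

Definition local_sol j x t : R := K * selfsim 0 s G x t + burst b (peak j) (N j) x t.

(** The open interval between the end [4 T_{j+1} = T_j / 4] of burst [j + 1] and the beginning
    [T_{j-1} / 2 = 8 T_j] of burst [j - 1], unbounded for [j = 0]. Only burst [j] can be nonzero
    there. *)
Definition window j : set R := [set t | peak j / 4 < t /\ (j = 0%N \/ t < 8 * peak j)].

Lemma window_open j : open (window j).
Proof.
case: j => [|j].
  rewrite (_ : window 0 = [set t : R | peak 0 / 4 < t]); first exact: open_gt.
  by apply/seteqP; split => t /=; [case|split => //; left].
rewrite (_ : window j.+1 = [set t : R | peak j.+1 / 4 < t] `&` [set t | t < 8 * peak j.+1]).
  by apply: openI; [exact: open_gt|exact: open_lt].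
by apply/seteqP; split => t /= [h1]; [case => // h2; split|move=> h2; split => //; right].
Qed.

Lemma index_exists t : exists j, 0 < t ->
  peak j / 4 < t /\ forall k, peak k / 4 < t -> (j <= k)%N.
Proof.
case: (ltP 0 t) => t0; last by exists 0%N.
have ex : exists j, peak j / 4 < t.
  have [j Hj] := exp16_unbounded (T0 / (4 * t)); exists j.
  move: Hj; rewrite /peak ltr_pdivrMr ?mulr_gt0// => Hj.
  by rewrite ltr_pdivrMr// ltr_pdivrMr ?exprn_gt0//; lra.
by case: (ex_minnP ex) => j Hj Hm; exists j => _; split.
Qed.

Lemma glue_exists : exists u : 'rV[R]_n -> R -> R,
  [/\ forall j x t, window j t -> u x t = local_sol j x t &
      forall t, 0 < t < 1 -> exists2 j, window j t & (j = 0%N \/ t <= 4 * peak j)].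
Proof.
have [J HJ] := choice index_exists.
have win t : 0 < t -> window (J t) t /\ (J t = 0%N \/ t <= 4 * peak (J t)).
  move=> t0; have [H1 H2] := HJ t t0.
  have aux : J t = 0%N \/ t <= 4 * peak (J t).
    case E : (J t) => [|j]; [by left|right].
    rewrite leNgt; apply/negP => H.
    have : (J t <= j)%N by apply: H2; rewrite peakS; lra.
    by rewrite E ltnn.
  split => //; split => //; case: aux => [->|H]; [by left|right].
  by have := peak_gt0 (J t); lra.
exists (fun x t => local_sol (J t) x t); split; last first.
  by move=> t /andP[t0 _]; exists (J t); have [] := win t t0.
move=> j x t [w1 w2]; have p0 := peak_gt0 j.
have t0 : 0 < t by apply: lt_trans w1; rewrite divr_gt0.
have [H1 H2] := HJ t t0.
have := H2 j w1; rewrite leq_eqVlt => /orP[/eqP ->//|Jj].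
case: w2 => [j0|w2]; first by rewrite j0 in Jj.
case: j => [//|j] in w1 w2 p0 Jj *.
have pJ := peak_gt0 (J t).
have := peak_le Jj; rewrite -/(peak _) => pp.
have ppj : peak j <= peak (J t) by exact: peak_le.
have E := peakS j.
(* At a time common to the windows of [J t < j], burst [J t] has not begun and burst [j] is already
   off, so both formulas reduce to the background. *)
rewrite /local_sol !burst_eq0 ?peak_gt0//.
  by apply/orP; right; lra.
by apply/orP; left; lra.
Qed.

Lemma local_sol_Ck_on j k : Ck_on (window j) k (local_sol j).
Proof.
apply: Ck_onD; last exact: Ck_on_sub (burst_Ck_on _ _ _ (peak_gt0 j)).
apply: Ck_onM; first exact: Ck_on_cst.
apply: selfsim_Ck_on => //; first exact: window_open.
by move=> t [h _]; apply: lt_trans h; rewrite divr_gt0// peak_gt0.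
Qed.

Lemma is_heat_local_sol j x t : 0 < t -> is_heat (local_sol j) x t
  (K * bgheat s G x t + ((1 - chi (t / (2 * peak j))) * (\sum_(i < N j) source b (peak j) i x t) -
   dchi (t / (2 * peak j)) / (2 * peak j) * \sum_(i < N j) piece b (peak j) i x t)).
Proof.
move=> t0; apply: is_heatD; last exact: is_heat_burst (peak_gt0 j).
have := is_heatM_time (is_derive_cst K t 1) (is_heat_selfsim s x TG t0).
by rewrite /= subr0 mul0r addr0.
Qed.

End glueing.

(** * Separation of the sources *)

Section solution_estimates.
Set Implicit Arguments.
Unset Strict Implicit.
Context {R : realType} {n : nat}.
Implicit Types (x y : 'rV[R]_n) (t T : R).

Lemma scale_small T (d : R) : 0 < T -> 0 < d -> exists i, scale T i <= d.
Proof.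
move=> T0 d0; have [j Hj] := exp16_unbounded (T / d).
exists (2 * j)%N; rewrite /scale ler_pdivrMr ?exprn_gt0//.
move: Hj; rewrite ltr_pdivrMr// => /ltW/le_trans; apply.
rewrite mulrC ler_pM2l// -(addn2 (2 * j)) exprD exprM (_ : 4 ^+ 2 = 16); last by rewrite -natrX.
by rewrite ler_peMr ?exprn_ge0// ler1n.
Qed.

(** The source of kernel [i] lives on [[T - 2 r_i, T - r_i]], and [r_{i+1} = r_i / 4] makes these
    intervals disjoint. *)
Lemma sources_separated (b T : R) (N : nat) x t : 0 < T ->
  (\sum_(i < N) source b T i x t = 0) \/
  exists i : 'I_N, T - 2 * scale T i <= t <= T - scale T i /\
    \sum_(i < N) source b T i x t = source b T i x t.
Proof.
move=> T0; have [/existsP[i Hi]|] := boolP [exists i : 'I_N, source b T i x t != 0].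
  right; exists i.
  have [H1 H2] : T - 2 * scale T i < t /\ t < T - scale T i.
    split; rewrite ltNge; apply: contra Hi => H; apply/eqP/source_eq0 => //.
      by apply/orP; left; rewrite /onset; lra.
    by apply/orP; right; rewrite /onset; lra.
  split; first by rewrite !ltW.
  rewrite (bigD1 i)//= big1 ?addr0// => k; rewrite neq_ltn => /orP[ki|ik].
    apply: source_eq0 => //; apply/orP; right.
    have := scale_le T0 ki; rewrite scaleS /onset; have := scale_gt0 k T0.
    by have := scale_gt0 i T0; lra.
  apply: source_eq0 => //; apply/orP; left.
  have := scale_le T0 ik; rewrite scaleS /onset; have := scale_gt0 k T0.
  by have := scale_gt0 i T0; lra.
rewrite negb_exists => /forallP H; left; apply: big1 => i _.
by have := H i; rewrite negbK => /eqP.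
Qed.

Lemma sum_piece_widen (b T : R) (N i : nat) x t : (i <= N)%N ->
  \sum_(k < i) piece b T k x t <= \sum_(k < N) piece b T k x t.
Proof.
move=> iN; rewrite -!(big_mkord xpredT (fun k => piece b T k x t)).
rewrite [leRHS](@big_cat_nat _ _ _ i)//= lerDl.
by apply: sumr_ge0 => k _; exact: piece_ge0.
Qed.

End solution_estimates.

(** * Choice of the constants and verification of the claims *)

Theorem theorem5p3 (R : realType) (n : nat) (alpha lambda sigma : R)
  (phi : R -> R) :
  (1 <= n)%N ->
  0 < alpha < n%:R + 2 ->
  (n%:R + 2) / n%:R <= lambda ->
  0 <= sigma ->
  1 + (2 - alpha) / (n%:R + 2) * lambda < sigma ->
  {within `]0, 1[, continuous phi} ->
  (forall t, 0 < t < 1 -> 0 < phi t) ->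
  phi t @[t --> 0^'+] --> +oo ->
  exists u : 'rV[R]_n -> R -> R,
    [/\ forall x t, 0 < t < 1 -> 0 < u x t,
        smooth_strip u,
        (STint (fun y s => ((`|u y s|) `^ lambda)%:E) < +oo)%E,
        (forall x t, 0 < t < 1 ->
           0 <= Dt u x t - lap u x t /\
           ((Dt u x t - lap u x t)%:E <=
             STint (fun y s =>
               ((Phi (x - y) (t - s)) `^ (alpha / n%:R) * (u y s) `^ lambda)%:E)
             * ((u x t) `^ sigma)%:E)%E)
      & ~ (exists C : R, \forall t \near 0^'+, `|u 0 t| <= C * `|phi t|)].
Proof.
move=> n0 hal hl sg0 hs _ phi0 _; have /andP[al0 _] := hal.
have [l1 [s [s1 [[s0 ss1 s1n snl s1l] D0]]]] := exponents_exist n0 hal hl sg0 hs.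
have l0 : 0 < lambda by exact: lt_trans l1.
have sn : s < n%:R / 2 by exact: lt_trans s1n.
pose M := s * (lambda + sigma); pose m := (Num.truncn M).+1.
have Mm : M <= s + m%:R.
  by have := truncnS_gt M; rewrite -/m => /ltW h; rewrite (le_trans h)// lerDr ltW.
have [G [c [C [TG [c0 C0] HG HG2]]]] := profile m s0 sn.
have [K0 K00 HK0] := background_rhs n0 al0 l1 sg0 s0 D0 c0 C0 HG HG2 Mm.
have [C1 C10 HC1] := switch_off_le sn.
(* [K0] serves the inequality for the background, [C1 / c] lets its source absorb the switching-off
   of the bursts, and [1] lets [K w] dominate the background [w] used in the multiscale lower
   bound. *)
pose K := K0 + C1 / c + 1.
have Cc0 : 0 < C1 / c by rewrite divr_gt0.
have KK0 : K0 <= K by rewrite /K; lra.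
have K1 : 1 <= K by rewrite /K; lra.
have Kp : 0 < K by exact: lt_le_trans K1.
have KC1 : C1 <= K * c by rewrite -ler_pdivrMr// /K; lra.
have [c2 c20 Hc2] := @multiscale_ge R n s s0 c c0.
have [Ts Ts0 HTs] := source_rhs n0 al0 l1 sg0 s0 D0 c20.
pose T0 := Num.min Ts 4^-1.
have T00 : 0 < T0 by rewrite lt_min Ts0 invr_gt0 ltr0n.
have T04 : T0 <= 4^-1 by rewrite ge_min lexx orbT.
have T0s : T0 <= Ts by rewrite ge_min lexx.
pose b : R := n%:R / 2 - s.
(* [I j] is a kernel whose height at [(0, T_j)], bounded below by [piece_ge], exceeds [j phi(T_j)];
   the burst stops with it. *)
have /choice [I HI] j : exists i, j%:R * phi (peak T0 j) <
    3 `^ (- (n%:R / 2)) * scale (peak T0 j) i `^ (- s).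
  have p0 := peak_gt0 T00 j; pose Y := (`|j%:R * phi (peak T0 j)| + 1) / 3 `^ (- (n%:R / 2)).
  have Y0 : 0 < Y by rewrite divr_gt0 ?powR_gt0// ltr_wpDl.
  have [i Hi] := scale_small p0 (powR_gt0 (- s^-1) Y0); exists i.
  have : Y <= scale (peak T0 j) i `^ (- s).
    have -> : Y = (Y `^ (- s^-1)) `^ (- s).
      by rewrite -powRrM mulrNN mulVf ?gt_eqF// powRr1// ltW.
    by apply: powR_anti; rewrite ?(ltW s0)// scale_gt0.
  rewrite /Y ler_pdivrMr ?powR_gt0// => h; rewrite [X in _ < X]mulrC.
  by apply: lt_le_trans h; rewrite (le_lt_trans (ler_norm _))// ltrDl.
pose N j := (I j).+1.
have [u [uE uW]] := @glue_exists R n s K G T0 N T00.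
have wpos j t : window T0 j t -> 0 < t.
  by move=> [h _]; apply: lt_trans h; rewrite divr_gt0// peak_gt0.
have wbd (y : 'rV[R]_n) t : 0 < t -> c * (sqnorm y + t) `^ (- s) <= selfsim 0 s G y t <= C * (sqnorm y + t) `^ (- s).
  exact: background_bounds.
have wge (y : 'rV[R]_n) t : 0 < t -> c * (sqnorm y + t) `^ (- s) <= selfsim 0 s G y t.
  by move=> t0; have /andP[] := wbd y t t0.
have wgt (y : 'rV[R]_n) t : 0 < t -> 0 < selfsim 0 s G y t.
  move=> t0; apply: lt_le_trans (wge y t t0).
  by rewrite mulr_gt0 ?powR_gt0// ltr_wpDl ?sqnorm_ge0.
have uK y t : 0 < t < 1 -> K * selfsim 0 s G y t <= u y t.
  by move=> t01; have [j wj _] := uW t t01; rewrite (uE j)// lerDl burst_ge0.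
have rhs1 := HK0 K u KK0 uK.
exists u; split.
- move=> x t t01; apply: lt_le_trans (uK x t t01).
  by case/andP: t01 => t0 _; rewrite mulr_gt0 ?wgt.
- move=> k; apply: Ck_on_Ck; apply: Ck_on_local => t t01.
  have [j wj _] := uW t t01.
  exists (window T0 j), (local_sol s K G T0 N j); split => //.
  + exact: window_open.
  + exact: local_sol_Ck_on.
  + by move=> y v wv; exact: uE.
- have [|A [k [A0 k01 HA]]] := @iint_solution_le R n lambda s s1 K C G n0 l0 s0 ss1 s1n snl Kp C0.
    by move=> y t t0; have /andP[_ ->] := wbd y t t0; rewrite andbT ltW ?wgt.
  apply: (@STint_lt_pinfty R n _ T0 A (s * lambda - n%:R / 2) (s1 * lambda - n%:R / 2) k N) => //.
  + by rewrite T00 (le_trans T04)// invf_le1// ler1n.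
  + have : s * lambda < s1 * lambda by rewrite ltr_pM2r.
    lra.
  + lra.
  + move=> t t01; have [j wj tj] := uW t t01; have /andP[t0 t1] := t01; exists j.
      have [h1 _] := wj; rewrite (ltW h1) /=; case: tj => [->|h].
        by rewrite expr0 invr1 ltW.
      apply: le_trans h _; rewrite /peak mulrA -[leRHS]mul1r ler_pM2r ?invr_gt0 ?exprn_gt0//; lra.
    have -> : (fun y => (`|u y t| `^ lambda)%:E) = (fun y => (`|local_sol s K G T0 N j y t| `^ lambda)%:E).
      by apply/funext => y; rewrite (uE j).
    apply: HA => //; rewrite peak_gt0//= (le_trans (peak_le T00 (leq0n j)))//.
    by rewrite /peak expr0 divr1 (le_trans T04)// invf_le1// ler1n.
- move=> x t t01; have [j wj _] := uW t t01; have /andP[t0 t1] := t01.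
  have p0 := peak_gt0 T00 j; set T := peak T0 j in p0.
  have TT0 : T <= T0 by have := peak_le T00 (leq0n j); rewrite {2}/peak expr0 divr1.
  have Hh : is_heat u x t _ := is_heat_local (@window_open R T0 j) wj
    (fun y v wv => uE j y v wv) (is_heat_local_sol (n := n) s K N TG T00 j x t0).
  rewrite (is_heatE Hh) -/T -/b.
  have bg0 : 0 <= bgheat s G x t.
    apply: le_trans (bgheat_ge HG2 x t0).
    by rewrite !mulr_ge0 ?powR_ge0 ?expR_ge0// ltW.
  have S0 : 0 <= \sum_(i < N j) source b T i x t.
    by apply: sumr_ge0 => i _; exact: source_ge0.
  have off := HC1 T (N j) x t p0; rewrite -/b in off.
  have offK : C1 * (t `^ (- s - 1) * expR (- (sqnorm x / (4 * t)))) <= K * bgheat s G x t.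
    apply: (@le_trans _ _ (K * (c * (t `^ (- s - 1) * expR (- (sqnorm x / (4 * t))))))).
      by rewrite [leRHS]mulrA ler_wpM2r// mulr_ge0 ?powR_ge0 ?expR_ge0.
    by rewrite ler_pM2l// (bgheat_ge HG2).
  have off0 : 0 <= dchi (t / (2 * T)) / (2 * T) * \sum_(i < N j) piece b T i x t.
    apply: mulr_ge0; first by rewrite divr_ge0 ?dchi_ge0// mulr_ge0// ltW.
    by apply: sumr_ge0 => i _; exact: piece_ge0.
  have chi1 : 0 <= 1 - chi (t / (2 * T)) by rewrite subr_ge0 chi_le1.
  have Sle : (1 - chi (t / (2 * T))) * (\sum_(i < N j) source b T i x t) <=
      \sum_(i < N j) source b T i x t.
    by rewrite -[leRHS]mul1r ler_wpM2r// gerBl chi_ge0.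
  have Sge : 0 <= (1 - chi (t / (2 * T))) * (\sum_(i < N j) source b T i x t).
    by rewrite mulr_ge0.
  split; first by lra.
  have R1 := rhs1 x t t01.
  have R2 : ((2 * \sum_(i < N j) source b T i x t)%:E <= rhs alpha lambda sigma u x t)%E.
    have [->|[i [Hi ->]]] := sources_separated b (N j) x t p0.
      apply: le_trans R1; rewrite lee_fin mulr0; apply: mulr_ge0 => //.
      by apply: mulr_ge0 => //; exact: ltW.
    apply: HTs => //.
    + by rewrite p0 (le_trans TT0).
    + by apply: le_lt_trans TT0 _; lra.
    move=> y v Hv; have r0 := scale_gt0 i p0; have r16 := scale_le16 i p0.
    have wv : window T0 j v by split; [|right]; rewrite -/T; lra.
    have v0 : 0 < v by lra.
    rewrite (uE j)// /local_sol -/T -/b /burst chi_eq0; last first.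
      by rewrite ler_pdivrMr ?mulr_gt0//; lra.
    rewrite subr0 mul1r; apply: le_trans (Hc2 T i y p0) _; apply: lerD.
      apply: (@le_trans _ _ (selfsim 0 s G y v)); last first.
        by rewrite -[leLHS]mul1r ler_wpM2r// ltW// wgt.
      apply: le_trans (wge y v v0); rewrite ler_pM2l//.
      by apply: powR_anti; rewrite ?(ltW s0) ?lerD2l ?ltr_wpDl ?sqnorm_ge0//; lra.
    (* Only the kernels [k < i] are kept: each is fully switched on from [T - r_k <= T - 4 r_i]
       onwards, hence on the whole interval where the lower bound is wanted. *)
    apply: le_trans (sum_piece_widen _ _ _ _ (ltnW (ltn_ord i))).
    apply: ler_sum => k _; apply: piece_ge => //; rewrite /onset.
    have := scale_le p0 (ltn_ord k); rewrite scaleS; have := scale_gt0 k p0.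
    by move=> h1 h2; apply/andP; split; lra.
  rewrite -/(rhs alpha lambda sigma u x t).
  (* The heat operator gives at most the background source plus the burst source, hence at most
     twice the larger one; this is why [R1] and [R2] carry a factor [2]. *)
  case: (leP (K * bgheat s G x t) (\sum_(i < N j) source b T i x t)) => H.
    by apply: le_trans R2; rewrite lee_fin; lra.
  by apply: le_trans R1; rewrite lee_fin; lra.
- move=> [D [e /= e0 He]].
  have [j0 Hj0] := exp16_unbounded (T0 / e).
  (* [j0] brings the peak time below [e], and the second summand makes [j >= D], so the peak exceeds
     [D phi(T_j)]. *)
  pose j := (j0 + (Num.truncn `|D|).+1)%N; pose T := peak T0 j.
  have p0 : 0 < T by exact: peak_gt0.
  have TT0 : T <= T0 by have := peak_le T00 (leq0n j); rewrite {2}/peak expr0 divr1.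
  have Te : T < e.
    apply: le_lt_trans (peak_le T00 (leq_addr _ j0)) _.
    by move: Hj0; rewrite /peak !ltr_pdivrMr ?exprn_gt0// mulrC.
  have T01 : 0 < T < 1 by rewrite p0 (le_lt_trans TT0)//; lra.
  have Dj : D <= j%:R.
    apply: le_trans (ler_norm D) _; apply: le_trans (ltW (truncnS_gt `|D|)) _.
    by rewrite ler_nat leq_addl.
  have := He T; rewrite /ball /= sub0r normrN (gtr0_norm p0) => /(_ Te p0).
  apply/negP; rewrite -ltNge (gtr0_norm (phi0 T T01)).
  apply: le_lt_trans (_ : j%:R * phi T < _).
    by rewrite ler_wpM2r// ltW// phi0.
  apply: lt_le_trans (HI j) _; apply: le_trans (ler_norm _).
  rewrite (uE j); last by split; [|right]; rewrite -/T; lra.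
  rewrite /local_sol -/T -/b.
  apply: (@le_trans _ _ (piece b T (I j) 0 T)).
    have r0 := scale_gt0 (I j) p0.
    have := @piece_ge R n s T (I j) 0 T p0; rewrite -/b.
    have -> : sqnorm (0 : 'rV[R]_n) = 0 by rewrite /sqnorm big1// => k _; rewrite mxE expr0n.
    by rewrite mul0r oppr0 expR0 mulr1; apply; rewrite /onset; apply/andP; split; lra.
  rewrite /burst chi_eq0; last by rewrite ler_pdivrMr ?mulr_gt0//; lra.
  rewrite subr0 mul1r /N big_ord_recr /= addrA lerDr addr_ge0//.
    by rewrite mulr_ge0 ?(ltW Kp)// ltW// wgt.
  by apply: sumr_ge0 => k _; exact: piece_ge0.
Qed.
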